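(* Let $m,d\ge 1$ be integers, let $q_1,\dots,q_m \geq 2$ be pairwise co-prime integers and let $b(i,j) \in \{0,1\}$ for $1\le i\le d$, $1\le j\le m$, be such that for each $1 \leq i \leq d$ there exists some $1 \leq j \leq m$ with $b(i,j)=1$. Put $k_i = q_1^{b(i,1)} \cdots q_m^{b(i,m)}$ for $1 \leq i \leq d$. Then for every infinite set $\mathcal{A} \subseteq \mathbb{N}_0$ the function $n\mapsto r_{\mathcal{A}}(n;k_1,\dots,k_d)$ does not become constant; that is, there do not exist $c, N\in\mathbb{N}_0$ such that $r_{\mathcal{A}}(n;k_1,\dots,k_d)=c$ for all integers $n\ge N$.
   Context: $\mathbb{N}_0$ denotes the non-negative integers. For a set $\mathcal{A}\subseteq\mathbb{N}_0$, positive integers $k_1,\dots,k_d$ and $n\in\mathbb{N}_0$, the representation function is $$r_{\mathcal{A}}(n;k_1,\dots,k_d) = \# \big\{ (a_1, \dots, a_d) \in \mathcal{A}^d : k_1 a_1 + \dots + k_d a_d = n \big\}.$$ *)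

(* Defs.v *)
From mathcomp Require Import all_boot finmap.
From mathcomp Require Import boolp classical_sets functions cardinality.

Set Implicit Arguments.
Unset Strict Implicit.
Unset Printing Implicit Defensive.

Local Open Scope classical_set_scope.
Local Open Scope nat_scope.

Definition representations (d : nat) (A : set nat) (k : 'I_d -> nat) (n : nat) :
    set {ffun 'I_d -> nat} :=
  [set a | (forall i, A (a i)) /\ \sum_(i < d) k i * a i = n].

(* [fset_set] returns the empty [fset] on infinite sets; this cannot happen
   when all the [k i] are positive, by [finite_representations] below. *)
Definition repr_count (d : nat) (A : set nat) (k : 'I_d -> nat) (n : nat) : nat :=
  #|` fset_set (representations A k n)|%fset.

Lemma finite_representations (d : nat) (A : set nat) (k : 'I_d -> nat) (n : nat) :
  (forall i, 0 < k i) -> finite_set (representations A k n).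
Proof.
move=> k_gt0.
pose f (g : {ffun 'I_d -> 'I_n.+1}) : {ffun 'I_d -> nat} :=
  [ffun i => nat_of_ord (g i)].
apply: (@sub_finite_set _ _ (f @` setT)); last first.
  exact/finite_image/finite_finset.
move=> a [_ sum_a]; exists [ffun i => inord (a i)] => //.
apply/ffunP => i; rewrite !ffunE inordK // ltnS -sum_a (bigD1 i) //=.
by apply: leq_trans (leq_addr _ _); rewrite leq_pmull.
Qed.

(* Main.v *)
Require Import Defs.
From mathcomp Require Import all_boot all_order all_algebra cyclic all_field.
From mathcomp Require Import finmap complex.
From mathcomp Require Import all_classical all_reals all_analysis.
From mathcomp Require Import Rstruct.
From mathcomp Require Import ring lra zify.

Set Implicit Arguments.
Unset Strict Implicit.
Unset Printing Implicit Defensive.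

(** Suppose that the representation function is equal to c from some point on,
    and let F(z) be the sum of the powers z^a with a in A.  Expanding the
    product of the series F(z^(k_i)) gives P(z) / (1 - z) with P an integer
    polynomial and P(1) = c ([absF_prod]).  As A is infinite, c > 0
    ([eventual_value_gt0]); hence no q_l divides every k_i, since otherwise
    only multiples of q_l would be represented ([eventual_value_eq0]).

    The proof compares orders of vanishing at roots of unity.  For an exponent
    vector e let n(e) be the product of the q_l^(e_l).  Assume for a moment
    that log |F(r zeta)| behaves like f(e) log(1 - r) as r tends to 1, for zeta
    of order n(e).  The q_l being pairwise coprime, zeta^(k_i) has order
    n((e - b_i)^+), where b_i is the i-th row of b and the difference is cut
    off at 0.  The product formula then reads

      sum over i of f((e - b_i)^+)  =  rho(e)   for every e,

    rho(e) being the order of P(z) / (1 - z) at the roots of unity of order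
    n(e).  It is an integer which depends on e alone, because cyclotomic
    polynomials are irreducible over the rationals; it vanishes when e is
    large, because P has finitely many roots; and rho(0) = -1, because
    P(1) <> 0.  The contradiction has two halves.

    Existence of f.  The limits defining f need not exist: the factors of the
    product are evaluated at different radii r^(k_i) and at different
    conjugates.  Both obstructions disappear for a family of points w(e, s),
    indexed also by a scale vector s, for which taking the k_i-th power
    subtracts b_i from s and from e, cut off at 0 for e ([phase_system] gives
    the arguments of these points, and the radius of w(e, s) is
    exp(- tau / n(s))).  The product formula becomes an additive relation
    between the numbers log |F(w(e, s))|, up to an error bounded for each e
    ([log_growth_at_prim_roots]).  Averaging over boxes of scales makes the
    shifts of s negligible, and a limit along an ultrafilter yields an exact
    bounded solution f ([averaged_solution]).

    Impossibility of f.  The cut-off shift e -> (e - 1)^+ has for every |x| < 1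
    the left eigenvector 1, x - 1, (x - 1) x, (x - 1) x^2, and so on, with
    eigenvalue x.  Pairing the equation with products of such vectors at a
    point X where the sum of the monomials X^(b_i) is 0 shows that the
    corresponding pairing of rho vanishes ([sum_wt_eq0]).  A suitable curve of
    such points turns this into a polynomial identity, and at its end point the
    identity says that a sum of two coprime positive integers divides a power
    of one of them, which is absurd ([no_bounded_solution]). *)

(** * The clipped shift and its eigenfunctionals *)

Section Algebra.
Import Order.TTheory GRing.Theory Num.Theory.
Local Open Scope ring_scope.

(** Exponent vectors take their values in [nat], so that the truncated subtraction
    of [nat] is exactly the cut-off at 0 that comes with orders of powers of
    roots of unity. *)
Definition lower m (e : 'I_m -> nat) (b : 'I_m -> bool) : 'I_m -> nat :=
  fun l => (e l - b l)%N.

Definition idx m B (e : {ffun 'I_m -> 'I_B}) : 'I_m -> nat := fun l => e l.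

(** The left eigenvector, for the eigenvalue [x], of the cut-off shift
    [f |-> f (_ - 1)] on sequences: the mass [1 + (x - 1)] that the shift sends
    to 0 equals [x]. *)
Definition wt (A : nzRingType) (x : A) (a : nat) : A :=
  if a is a'.+1 then (x - 1) * x ^+ a' else 1.

(** The eigenvector equation on an initial segment; it fails at the last point
    [B] only, whose successor has been cut off. *)
Lemma sum_wt_lower (A : nzRingType) (x : A) (B : nat) (c : bool) (a' : 'I_B.+1) :
  (0 < B)%N ->
  \sum_(a < B.+1 | (a - c)%N == a') wt x a =
  if c then (if a' == B :> nat then 0 else x * wt x a') else wt x a'.
Proof.
move=> B0; case: c; last first.
  rewrite (big_pred1 a') // => a; rewrite subn0 //.
case: a' => -[|a'] /= ltaB.
  rewrite ifN; last by rewrite eq_sym -lt0n.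
  rewrite mulr1 (bigD1 ord0) //= (bigD1 (Ordinal (B0 : 1 < B.+1)%N)) //= big1.
    by rewrite expr0 mulr1 addr0 addrC subrK.
  by move=> [[|[|a]] lta] //=.
have [eB|nB] := eqVneq a'.+1 B.
  rewrite big_pred0 // => -[[|a] lta] //=; rewrite subSS subn0 eqE /=.
  by move: ltaB lta; rewrite -eB; lia.
have lt2 : (a'.+2 < B.+1)%N by lia.
rewrite (big_pred1 (Ordinal lt2)) /=.
  by rewrite mulrA mulrBr mulrBl exprS mulr1 mul1r !mulrA mulrBl.
move=> [[|a] lta] //=; rewrite -(inj_eq val_inj) /= subSS subn0 //.
Qed.

(** The shift acts on each coordinate separately, so the eigenvector equation
    is multiplicative over the coordinates. *)
Lemma sum_wt_lower_box (A : comNzRingType) m B (X : 'I_m -> A) (b : 'I_m -> bool)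
   (f : ('I_m -> nat) -> A) : (0 < B)%N ->
  \sum_(e : {ffun 'I_m -> 'I_B.+1})
     (\prod_l wt (X l) (e l)) * f (lower (idx e) b) =
  \sum_(e : {ffun 'I_m -> 'I_B.+1})
     (\prod_l if b l then (if e l == B :> nat then 0 else X l * wt (X l) (e l))
              else wt (X l) (e l)) * f (idx e).
Proof.
move=> B0.
pose low (e : {ffun 'I_m -> 'I_B.+1}) : {ffun 'I_m -> 'I_B.+1} :=
  [ffun l => inord (e l - b l)].
have lowE e : idx (low e) = lower (idx e) b.
  apply/funext => l; rewrite /idx ffunE inordK //.
  exact: leq_ltn_trans (leq_subr _ _) (ltn_ord _).
rewrite (partition_big low xpredT) //=; apply: eq_bigr => e' _.
transitivity (\sum_(e | low e == e') (\prod_l wt (X l) (e l)) * f (idx e')).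
  by apply: eq_bigr => e /eqP <-; rewrite lowE.
rewrite -mulr_suml; congr (_ * _).
under [RHS]eq_bigr => l _ do rewrite -sum_wt_lower //.
rewrite bigA_distr_big_dep /=; apply: eq_bigl => e.
apply/eqP/familyP => [<- l|H].
  by rewrite unfold_in /= /low ffunE inordK // (leq_ltn_trans (leq_subr _ _)).
apply/ffunP => l; apply/val_inj; rewrite ffunE /= inordK.
  by apply/eqP; exact: (H l).
exact: leq_ltn_trans (leq_subr _ _) (ltn_ord _).
Qed.

Lemma wt_bound (R : realType) (x r : R) a :
  `|x| <= r -> r <= 1 -> `|wt x a| <= 2 * r ^+ a.-1.
Proof.
move=> xr r1; have r0 : 0 <= r by apply: le_trans xr.
case: a => [|a] /=; first by rewrite normr1 expr0 mulr1 ler1n.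
rewrite normrM normrX ler_pM ?exprn_ge0 //; last by rewrite lerXn2r ?nnegrE.
by rewrite (le_trans (ler_normB _ _)) // normr1; lra.
Qed.

Lemma sum_box_support (A : nmodType) m B0 B (G : ('I_m -> nat) -> A) :
  (B0 <= B)%N -> (forall e l, (B0 < e l)%N -> G e = 0) ->
  \sum_(e : {ffun 'I_m -> 'I_B.+1}) G (idx e) =
  \sum_(e : {ffun 'I_m -> 'I_B0.+1}) G (idx e).
Proof.
move=> leB G0.
pose wid (e : {ffun 'I_m -> 'I_B0.+1}) : {ffun 'I_m -> 'I_B.+1} :=
  [ffun l => inord (e l)].
pose res (e : {ffun 'I_m -> 'I_B.+1}) : {ffun 'I_m -> 'I_B0.+1} :=
  [ffun l => inord (e l)].
have lt_wid (e : {ffun 'I_m -> 'I_B0.+1}) l : (e l < B.+1)%N.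
  by apply: leq_trans (ltn_ord _) _.
rewrite (bigID (fun e : {ffun 'I_m -> 'I_B.+1} => [forall l, (e l <= B0)%N])) /=.
rewrite [X in _ + X]big1 ?addr0; last first.
  by move=> e; rewrite negb_forall => /existsP[l]; rewrite -ltnNge => lt; apply: (G0 _ l).
rewrite (reindex_onto wid res) /=; last first.
  move=> e /forallP le_e; apply/ffunP => l; apply/val_inj.
  by rewrite !ffunE /= !inordK // ?ltnS //; exact: le_e.
apply: eq_big => [e|e _].
  apply/andP; split.
    by apply/forallP => l; rewrite ffunE inordK // -ltnS.
  apply/eqP/ffunP => l; apply/val_inj; rewrite !ffunE /= !inordK //.
by congr G; apply/funext => l; rewrite /idx ffunE inordK.
Qed.

Lemma eq0_of_le_expr2 (R : realType) (v D : R) (B0 : nat) :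
  (forall B, (B0 <= B)%N -> `|v| * 2 ^+ B <= D) -> v = 0.
Proof.
move=> H; apply/eqP; rewrite -normr_eq0; apply/negPn/negP => v0.
have v_gt0 : 0 < `|v| by rewrite lt_def v0 /=.
pose n := Num.truncn (D / `|v|).
have := H (B0 + n.+1)%N (leq_addr _ _).
apply/negP; rewrite -ltNge mulrC -ltr_pdivrMr //.
apply: lt_le_trans (Num.Theory.truncnS_gt (D / `|v|)) _.
rewrite -natrX ler_nat -/n.
by apply: leq_trans (ltnW (ltn_expl _ (ltnSn 1))) _; rewrite leq_exp2l // leq_addl.
Qed.

(** When the eigenvalues [\prod_(l | b i l) X l] of the shifts add up to 0, the
    two sides of the eigenvector equations cancel, apart from the indices having
    a coordinate [B].  There are at most [(B + 1) ^ m] of these, and each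
    carries a weight of order [r ^ B]. *)
Lemma sum_wt_trunc (R : realType) m d B (b : 'I_d -> 'I_m -> bool)
    (f : ('I_m -> nat) -> R) (C r : R) (X : 'I_m -> R) :
  (0 < B)%N -> 0 <= C -> 0 <= r -> r <= 1 ->
  (forall e, `|f e| <= C) -> (forall l, `|X l| <= r) ->
  \sum_(i < d) \prod_(l | b i l) X l = 0 ->
  `|\sum_(e : {ffun 'I_m -> 'I_B.+1}) (\prod_l wt (X l) (e l)) *
      \sum_(i < d) f (lower (idx e) (b i))|
  <= d%:R * C * (B.+1 ^ m)%:R * (2 ^+ m.+1 * r ^+ B.-1).
Proof.
move=> B0 C0 r0 r1 fC Xr K0.
under eq_bigr => e _ do rewrite mulr_sumr.
rewrite exchange_big /=.
have -> : \sum_(i < d) \sum_(e : {ffun 'I_m -> 'I_B.+1})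
    (\prod_l wt (X l) (e l)) * f (lower (idx e) (b i)) =
  \sum_(i < d) \sum_(e : {ffun 'I_m -> 'I_B.+1})
    ((\prod_l if b i l then (if e l == B :> nat then 0 else X l * wt (X l) (e l))
              else wt (X l) (e l)) -
     (\prod_(l | b i l) X l) * (\prod_l wt (X l) (e l))) * f (idx e).
  (* By K0, the sum is unchanged when each shifted sum is diminished by its
     eigenvalue times the unshifted one. *)
  have Z : 0 = \sum_(i < d) (\prod_(l | b i l) X l) *
      (\sum_(e : {ffun 'I_m -> 'I_B.+1}) (\prod_l wt (X l) (e l)) * f (idx e)).
    by rewrite -mulr_suml K0 mul0r.
  rewrite -[LHS]subr0 [X in _ - X]Z -sumrB.
  apply: eq_bigr => i _; rewrite sum_wt_lower_box // mulr_sumr -sumrB.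
  by apply: eq_bigr => e _; rewrite mulrBl mulrA.
have bnd i (e : {ffun 'I_m -> 'I_B.+1}) :
  `|((\prod_l if b i l then (if e l == B :> nat then 0 else X l * wt (X l) (e l))
              else wt (X l) (e l)) -
     (\prod_(l | b i l) X l) * (\prod_l wt (X l) (e l))) * f (idx e)|
  <= 2 ^+ m.+1 * r ^+ B.-1 * C.
  have prodE : (\prod_(l | b i l) X l) * (\prod_l wt (X l) (e l)) =
     \prod_l (if b i l then X l * wt (X l) (e l) else wt (X l) (e l)).
    rewrite big_mkcond -big_split /=; apply: eq_bigr => l _.
    by case: (b i l); rewrite ?mul1r.
  (* Unless a shifted coordinate is equal to B, the difference is 0. *)
  have [[l /andP[bl el]]|none] := pselect (exists l, b i l && (e l == B :> nat)).
    rewrite [X in X - _](bigD1 l) //= bl el mul0r sub0r normrM normrN ler_pM //.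
    rewrite prodE (bigD1 l) //= bl normrM normrM normr_prod.
    have W l' : `|wt (X l') (e l')| <= 2.
      apply: le_trans (wt_bound _ (Xr l') r1) _.
      by rewrite ler_piMr // exprn_ile1 //.
    have W' : \prod_(l' < m | l' != l)
        `|if b i l' then X l' * wt (X l') (e l') else wt (X l') (e l')| <= 2 ^+ m.
      apply: (@le_trans _ _ (\prod_(l' < m | l' != l) 2)).
        apply: ler_prod => l' _; rewrite normr_ge0 /=.
        case: (b i l') => //; rewrite normrM -[2]mul1r ler_pM //.
        by rewrite (le_trans (Xr _)).
      rewrite prodr_const ler_eXn2l ?ltr1n //.
      by rewrite -[X in (_ <= X)%N](card_ord m) max_card.
    have W1 : `|wt (X l) (e l)| <= 2 * r ^+ B.-1.
      by rewrite -[X in _ ^+ X.-1](eqP el); apply: wt_bound.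
    have -> : 2 ^+ m.+1 * r ^+ B.-1 = 1 * (2 * r ^+ B.-1) * 2 ^+ m.
      by rewrite exprS; ring.
    have X1 : `|X l| <= 1 by apply: le_trans (Xr l) r1.
    by apply: ler_pM; [apply: mulr_ge0|exact: prodr_ge0|exact: ler_pM|].
  rewrite prodE [X in X - _](eq_bigr (fun l =>
    if b i l then X l * wt (X l) (e l) else wt (X l) (e l))).
    by rewrite subrr mul0r normr0; apply: mulr_ge0 => //; apply: mulr_ge0; apply: exprn_ge0.
  move=> l _; case: ifP => // bl; case: ifP => // el.
  by case: none; exists l; rewrite bl.
apply: le_trans (ler_norm_sum _ _ _) _.
apply: (@le_trans _ _ (\sum_(i < d) \sum_(e : {ffun 'I_m -> 'I_B.+1})
   2 ^+ m.+1 * r ^+ B.-1 * C)).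
  apply: ler_sum => i _; apply: le_trans (ler_norm_sum _ _ _) _.
  by apply: ler_sum => e _.
rewrite !sumr_const card_ffun !card_ord.
rewrite -[X in X *+ d]mulr_natr -[X in X <= _]mulr_natr.
by rewrite le_eqVlt; apply/orP; left; apply/eqP; ring.
Qed.

(** The bound [2 ^- m.+1] on the eigenvalues makes the boundary terms, roughly
    [(B + 1) ^ m] times the [B]-th power of the bound, decay like [2 ^- B]; as
    [rho] has finite support, its pairing does not depend on [B]. *)
Lemma sum_wt_eq0 (R : realType) m d (b : 'I_d -> 'I_m -> bool)
    (rho f : ('I_m -> nat) -> R) (C : R) (X : 'I_m -> R) (B0 : nat) :
  (forall e, `|f e| <= C) -> (forall l, `|X l| <= 2 ^- m.+1) ->
  (forall e, \sum_(i < d) f (lower e (b i)) = rho e) ->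
  (forall e l, (B0 < e l)%N -> rho e = 0) ->
  \sum_(i < d) \prod_(l | b i l) X l = 0 ->
  \sum_(e : {ffun 'I_m -> 'I_B0.+1}) (\prod_l wt (X l) (e l)) * rho (idx e) = 0.
Proof.
move=> fC Xr frho rho0 K0.
have C0 : 0 <= C by apply: le_trans (fC (fun=> 0%N)).
apply: (@eq0_of_le_expr2 _ _ (d%:R * C * 2 ^+ (m + m.+1 + m.+1)) B0.+1) => B leB.
rewrite -(@sum_box_support _ m B0 B
   (fun e => (\prod_l wt (X l) (e l)) * rho e)) ?(ltnW leB) //; last first.
  by move=> e l /rho0 ->; rewrite mulr0.
under eq_bigr => e _ do rewrite -frho.
have B_gt0 : (0 < B)%N by apply: leq_trans leB.
have r0 : 0 <= 2 ^- m.+1 :> R by rewrite invr_ge0 exprn_ge0.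
have r1 : 2 ^- m.+1 <= 1 :> R by rewrite invf_le1 ?exprn_gt0 // exprn_ege1 // ler1n.
have := sum_wt_trunc B_gt0 C0 r0 r1 fC Xr K0.
set v := `| _ | => vle.
apply: (@le_trans _ _ (d%:R * C * (B.+1 ^ m)%:R *
   (2 ^+ m.+1 * (2 ^- m.+1) ^+ B.-1) * 2 ^+ B)).
  by rewrite ler_wpM2r ?exprn_ge0.
have -> : d%:R * C * (B.+1 ^ m)%:R * (2 ^+ m.+1 * (2 ^- m.+1) ^+ B.-1) * 2 ^+ B
   = d%:R * C * ((B.+1 ^ m)%:R * (2 ^+ m.+1 * (2 ^- m.+1) ^+ B.-1) * 2 ^+ B) :> R.
  by ring.
rewrite ler_wpM2l ?mulr_ge0 //.
rewrite exprVn -exprM; set N := (m.+1 * B.-1)%N.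
have -> : (B.+1 ^ m)%:R * (2 ^+ m.+1 / 2 ^+ N) * 2 ^+ B
    = (B.+1 ^ m)%:R * 2 ^+ m.+1 * 2 ^+ B / 2 ^+ N :> R by ring.
rewrite ler_pdivrMr ?exprn_gt0 // -!natrX -!natrM ler_nat.
apply: (@leq_trans ((2 ^ B) ^ m * 2 ^ m.+1 * 2 ^ B)).
  have le_exp k : (B.+1 ^ k <= (2 ^ B) ^ k)%N.
    by case: k => // k; rewrite leq_exp2r // ltn_expl.
  by rewrite !leq_mul.
rewrite -expnM -!expnD leq_exp2l //; nia.
Qed.

(** The weight [wt (u / v)] with its denominators cleared; homogeneous of degree
    [a] in [(u, v)]. *)
Definition hwt (A : nzRingType) (u v : A) (a : nat) : A :=
  if a is a'.+1 then (u - v) * u ^+ a' else 1.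

Lemma hwt_frac (F : fieldType) (u v : F) a :
  v != 0 -> hwt u v a = v ^+ a * wt (u / v) a.
Proof.
move=> v0; case: a => [|a] /=; first by rewrite expr0 mulr1.
rewrite expr_div_n exprS; have va : v ^+ a != 0 by rewrite expf_neq0.
by field; rewrite va v0.
Qed.

Lemma hwtZ (A : comNzRingType) (c u v : A) a :
  hwt (c * u) (c * v) a = c ^+ a * hwt u v a.
Proof.
case: a => [|a] /=; first by rewrite mulr1.
by rewrite exprMn exprS; ring.
Qed.

Lemma rmorph_wt (A A' : nzRingType) (h : {rmorphism A -> A'}) x a :
  h (wt x a) = wt (h x) a.
Proof. by case: a => [|a] /=; rewrite ?rmorph1 // rmorphM rmorphB rmorphXn rmorph1. Qed.

Lemma rmorph_hwt (A A' : nzRingType) (h : {rmorphism A -> A'}) u v a :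
  h (hwt u v a) = hwt (h u) (h v) a.
Proof. by case: a => [|a] /=; rewrite ?rmorph1 // rmorphM rmorphB rmorphXn. Qed.

Lemma wt1E (A : nzRingType) a : wt (1 : A) a = (a == 0%N)%:R.
Proof. by case: a => [|a] //=; rewrite subrr mul0r. Qed.

Lemma prod_two_values (A : comNzRingType) m (c : 'I_m -> bool) (j : 'I_m) (x y : A) :
  \prod_(l | c l) (if l == j then x else y) =
  if c j then x * y ^+ #|[pred l | c l]|.-1 else y ^+ #|[pred l | c l]|.
Proof.
case: ifP => cj.
  rewrite (bigD1 j) //= eqxx; congr (_ * _).
  rewrite (eq_bigr (fun=> y)); last by move=> l /andP[_ /negbTE ->].
  rewrite prodr_const; congr (_ ^+ _); rewrite (cardD1 j [pred l | c l]) !inE cj /=.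
  by apply: eq_card => l; rewrite !inE andbC.
rewrite (eq_bigr (fun=> y)) ?prodr_const // => l cl.
by case: eqP => // lj; move: cl; rewrite lj cj.
Qed.

(** A polynomial that vanishes on an interval has more roots than its size. *)
Lemma poly_eq0_near0 (R : realType) (p : {poly R}) (delta : R) :
  0 < delta -> (forall y, 0 < y -> y <= delta -> p.[y] = 0) -> p = 0.
Proof.
move=> d0 H.
pose s := [seq delta / n.+1%:R | n <- iota 0 (size p)].
apply: (@roots_geq_poly_eq0 _ p s); last by rewrite size_map size_iota.
  apply/allP => _ /mapP[n _ ->]; apply/rootP/H; first by rewrite divr_gt0.
  by rewrite ler_pdivrMr // ler_peMr ?ler1n // ltW.
rewrite map_inj_uniq ?iota_uniq // => n1 n2.
move/(mulfI (lt0r_neq0 d0)) => /invr_inj/eqP.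
by rewrite eqr_nat => /eqP[].
Qed.

(** Let [i0] be a row of minimal weight and [j] one of its elements.  Put [X l = y]
    for [l != j]; the sum of the monomials [X^(b i)] is then affine in [X j], and
    vanishes at [X j = - k0 / k1], where [k0] and [k1] collect the rows without
    and with [j].  Minimality of [i0] makes [k0 / k1] of order [y], so that for
    small [y] the point lies in the polydisc where [sum_wt_eq0] applies.  After
    multiplication by a power of [k1] one gets a polynomial identity in [y],
    which may be evaluated at [y = 1].  There [k0] and [k1] are the numbers of
    rows without and with [j], both positive, and all weights of the other
    coordinates vanish except at exponent 0.  Dividing by the common factor of
    the two numbers leaves coprime [al] and [be] such that [al + be] divides
    [be ^ B0], the term with [rho 0 = -1], because it divides every other term. *)
Lemma no_bounded_solution (R : realType) m d (b : 'I_d -> 'I_m -> bool)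
    (rho : ('I_m -> nat) -> int) (f : ('I_m -> nat) -> R) (C : R) (B0 : nat) :
  (0 < d)%N -> (forall i, exists l, b i l) -> (forall l, exists i, ~~ b i l) ->
  (forall e, `|f e| <= C) ->
  (forall e, \sum_(i < d) f (lower e (b i)) = (rho e)%:~R) ->
  (forall e l, (B0 < e l)%N -> rho e = 0) ->
  rho (fun=> 0%N) <> -1.
Proof.
move=> d_gt0 b_row b_col fC frho rho_supp rho0.
pose w i := #|[pred l | b i l]|.
pose i0 := [arg min_(i < Ordinal d_gt0) w i]%N.
have w_min i : (w i0 <= w i)%N.
  by rewrite /i0; case: arg_minnP => // i1 _ ->.
have [j bj] := b_row i0; have [i1 bi1] := b_col j.
pose K0 : {poly R} := \sum_(i | ~~ b i j) 'X^(w i).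
pose K1 : {poly R} := \sum_(i | b i j) 'X^((w i).-1).
pose n0 := #|[pred i | ~~ b i j]|; pose n1 := #|[pred i | b i j]|.
have n0_gt0 : (0 < n0)%N by apply/card_gt0P; exists i1.
have n1_gt0 : (0 < n1)%N by apply/card_gt0P; exists i0.
(* The same expression is needed over {poly R}, R and int, at several points. *)
pose T (A : comNzRingType) (k0 k1 x : A) : A :=
  \sum_(e : {ffun 'I_m -> 'I_B0.+1}) (rho (idx e))%:~R *
    (k1 ^+ (B0 - e j) * hwt (- k0) k1 (e j) * \prod_(l | l != j) wt x (e l)).
have T_morph (A A' : comNzRingType) (h : {rmorphism A -> A'}) k0 k1 x :
    h (T A k0 k1 x) = T A' (h k0) (h k1) (h x).
  rewrite /T rmorph_sum /=; apply: eq_bigr => e _.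
  rewrite rmorphM rmorph_int !rmorphM rmorphXn rmorph_hwt rmorphN rmorph_prod.
  by congr (_ * (_ * _)); apply: eq_bigr => l _; rewrite rmorph_wt.
have w_gt0 : (0 < w i0)%N by apply/card_gt0P; exists j.
(* The threshold keeps both y and |k0 / k1| <= d * y below 2 ^- m.+1. *)
have TX0 : T _ K0 K1 'X = 0.
  apply: (@poly_eq0_near0 _ _ (2 ^- m.+1 / d%:R)).
    by rewrite divr_gt0 ?invr_gt0 ?exprn_gt0 // ltr0n.
  move=> y y_gt0 yle.
  have y1 : y <= 2 ^- m.+1.
    by apply: le_trans yle _; rewrite ler_pdivrMr ?ltr0n // ler_peMr ?ler1n ?invr_ge0 ?exprn_ge0.
  have y2 : y <= 1.
    by apply: le_trans y1 _; rewrite invf_le1 ?exprn_gt0 // exprn_ege1 // ler1n.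
  rewrite -[_.[y]]/(horner_eval y _) T_morph /=.
  set k0 := horner_eval y K0; set k1 := horner_eval y K1.
  have k0E : k0 = \sum_(i | ~~ b i j) y ^+ w i.
    by rewrite /k0 rmorph_sum; apply: eq_bigr => i _; rewrite /= /horner_eval hornerXn.
  have k1E : k1 = \sum_(i | b i j) y ^+ (w i).-1.
    by rewrite /k1 rmorph_sum; apply: eq_bigr => i _; rewrite /= /horner_eval hornerXn.
  have -> : horner_eval y 'X = y by rewrite /horner_eval hornerX.
  have k1_ge : y ^+ (w i0).-1 <= k1.
    rewrite k1E (bigD1 i0) //= lerDl; apply: sumr_ge0 => i _.
    by rewrite exprn_ge0 // ltW.
  have k1_gt0 : 0 < k1 by apply: lt_le_trans k1_ge; rewrite exprn_gt0.
  have k0_ge0 : 0 <= k0.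
    by rewrite k0E; apply: sumr_ge0 => i _; rewrite exprn_ge0 // ltW.
  have k0_le : k0 <= d%:R * y ^+ w i0.
    rewrite k0E; apply: (@le_trans _ _ (\sum_(i | ~~ b i j) y ^+ w i0)).
      by apply: ler_sum => i _; rewrite ler_wiXn2l // ltW.
    rewrite sumr_const -[X in X <= _]mulr_natl ler_wpM2r ?exprn_ge0 ?(ltW y_gt0) //.
    by rewrite ler_nat -[X in (_ <= X)%N](card_ord d) max_card.
  pose X l := if l == j then - k0 / k1 else y.
  have Xj : X j = - k0 / k1 by rewrite /X eqxx.
  have := @sum_wt_eq0 R m d b (fun e => (rho e)%:~R) f C X B0 fC _ frho.
  have -> : T _ k0 k1 y = k1 ^+ B0 * \sum_(e : {ffun 'I_m -> 'I_B0.+1})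
     (\prod_l wt (X l) (e l)) * (rho (idx e))%:~R.
    rewrite /T mulr_sumr; apply: eq_bigr => e _.
    rewrite hwt_frac ?gt_eqF // [\prod_l wt (X l) _](bigD1 j) //= Xj.
    rewrite [X in _ = _ * (_ * X * _)](eq_bigr (fun l => wt y (e l))); last first.
      by move=> l lj; rewrite /X (negbTE lj).
    have -> : k1 ^+ B0 = k1 ^+ (B0 - e j) * k1 ^+ e j.
      by rewrite -exprD subnK // -ltnS.
    by ring.
  move=> ->; first by rewrite mulr0.
  - move=> l; rewrite /X; case: ifP => _; last by rewrite gtr0_norm.
    rewrite normrM normrN normfV (ger0_norm k0_ge0) (gtr0_norm k1_gt0).
    rewrite ler_pdivrMr //; apply: le_trans k0_le _.
    apply: (@le_trans _ _ (2 ^- m.+1 * y ^+ (w i0).-1)).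
      rewrite -(prednK w_gt0) exprS mulrA ler_wpM2r ?exprn_ge0 ?(ltW y_gt0) //.
      by rewrite mulrC -ler_pdivlMr ?ltr0n.
    by rewrite ler_wpM2l // invr_ge0 exprn_ge0.
  - by move=> e l /rho_supp ->.
  rewrite (eq_bigr (fun i => if b i j then - k0 / k1 * y ^+ (w i).-1
    else y ^+ w i)); last by move=> i _; rewrite prod_two_values.
  rewrite (bigID (fun i => b i j)) /=.
  rewrite (eq_bigr (fun i => - k0 / k1 * y ^+ (w i).-1)); last by move=> i ->.
  rewrite -mulr_sumr -k1E [X in _ + X](eq_bigr (fun i => y ^+ w i)); last first.
    by move=> i /negbTE ->.
  by rewrite -k0E mulfVK ?gt_eqF // addNr.
have T1 : T int n0%:R n1%:R 1 = 0.
  apply/eqP; rewrite -(intr_eq0 R); apply/eqP.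
  rewrite -[_%:~R]/(intmul 1 _) T_morph !rmorph_nat rmorph1.
  transitivity (horner_eval 1 (T _ K0 K1 'X)); last by rewrite TX0 rmorph0.
  rewrite T_morph; congr (T _ _ _ _).
  - rewrite /K0 rmorph_sum (eq_bigr (fun=> 1)) ?sumr_const //.
    by move=> i _; rewrite /= /horner_eval hornerXn expr1n.
  - rewrite /K1 rmorph_sum (eq_bigr (fun=> 1)) ?sumr_const //.
    by move=> i _; rewrite /= /horner_eval hornerXn expr1n.
  - by rewrite /= /horner_eval hornerX.
pose g := gcdn n0 n1.
have g_gt0 : (0 < g)%N by rewrite gcdn_gt0 n0_gt0.
pose al := (n0 %/ g)%N; pose be := (n1 %/ g)%N.
have n0E : n0 = (g * al)%N by rewrite mulnC divnK // dvdn_gcdl.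
have n1E : n1 = (g * be)%N by rewrite mulnC divnK // dvdn_gcdr.
have al_gt0 : (0 < al)%N by move: n0_gt0; rewrite n0E muln_gt0 => /andP[].
have be_gt0 : (0 < be)%N by move: n1_gt0; rewrite n1E muln_gt0 => /andP[].
have cop : coprime al be.
  by rewrite /coprime -(eqn_pmul2l g_gt0) muln1 muln_gcdr -n0E -n1E.
have T2 : T int al%:R be%:R 1 = 0.
  apply/eqP; have := T1.
  have -> : T int n0%:R n1%:R 1 = g%:R ^+ B0 * T int al%:R be%:R 1.
    rewrite /T mulr_sumr; apply: eq_bigr => e _.
    rewrite n0E n1E !natrM -mulrN hwtZ exprMn.
    have -> : g%:R ^+ B0 = g%:R ^+ (B0 - e j) * g%:R ^+ e j :> int.
      by rewrite -exprD subnK // -ltnS.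
    by ring.
  move/eqP; rewrite mulf_eq0 expf_eq0 => /orP[/andP[_]|//].
  by rewrite pnatr_eq0 eqn0Ngt g_gt0.
have dv : (al + be %| be ^ B0)%N.
  pose e0 : {ffun 'I_m -> 'I_B0.+1} := [ffun=> ord0].
  have idx0 : idx e0 = fun=> 0%N by apply/funext => l; rewrite /idx ffunE.
  have := T2; rewrite /T (bigD1 e0) //= idx0 rho0 ffunE /= subn0 mulr1 big1; last first.
    by move=> l _; rewrite ffunE wt1E.
  rewrite mulr1 mulN1r => /eqP; rewrite addrC subr_eq0 => /eqP sumE.
  have : ((al + be)%N%:Z %| be%:Z ^+ B0)%Z.
    rewrite -[be%:Z]natz -sumE; apply: rpred_sum => e e_neq0.
    apply: dvdz_mull.
    (* At 1 the weight of a nonzero exponent is 0; so only multiples of the j-th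
       unit vector contribute, and for these hwt has the factor - (al + be). *)
    have [[l /andP[lj el]]|none] :=
      pselect (exists l, (l != j) && (e l != 0%N :> nat)).
      by rewrite (bigD1 l) //= wt1E (negbTE el) mul0r mulr0 dvdz0.
    apply: dvdz_mulr; apply: dvdz_mull.
    case ej : (nat_of_ord (e j)) => [|a] /=.
      case/eqP: e_neq0; apply/ffunP => l; apply/val_inj; rewrite ffunE /=.
      have [->//|lj] := eqVneq l j; apply/eqP/negPn/negP => el.
      by case: none; exists l; rewrite lj.
    by apply: dvdz_mulr; rewrite !natz -opprD dvdzE abszN.
  by rewrite dvdzE abszX.
have /eqP : coprime (al + be) (be ^ B0).
  by rewrite coprimeXr // coprime_sym /coprime gcdnDr -[gcdn _ _ == _]/(coprime _ _) coprime_sym.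
rewrite (gcdn_idPl dv); lia.
Qed.

End Algebra.

(** * Averaging over scales *)

Section Averaging.
Import Order.TTheory GRing.Theory Num.Theory.
Import numFieldNormedType.Exports.
Local Open Scope classical_set_scope.
Local Open Scope ring_scope.

(** One filter serves all bounded sequences at once, which makes the limits
    below additive. *)
Lemma ultrafilter_limits (R : realType) :
  exists U : set_system nat, [/\ ProperFilter U, \oo `<=` U &
    forall (u : nat -> R) (C : R), (forall n, `|u n| <= C) -> exists l : R, u @ U --> l].
Proof.
have [U [UU sub]] := @ultraFilterLemma nat \oo _.
have UP : ProperFilter U by case: UU.
exists U; split => // u C uC.
have [|p [_ clp]] := @segment_compact R (- C) C (u @ U) _.
  rewrite /= /nbhs /=; apply: (@filterS _ U _ setT) => [n _|]; last exact: filterT.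
  by rewrite /= in_itv /= -ler_norml.
exists p => V Vp.
have [//|UnV] := in_ultra_setVsetC (u @^-1` V) UU.
by have [x []] := clp (~` V) V UnV Vp.
Qed.

Definition raise m (s : 'I_m -> nat) (c : 'I_m -> bool) : 'I_m -> nat :=
  fun l => (s l + c l)%N.

(** Multiplied out to avoid the exponent [m - 1]. *)
Lemma card_face m M (l : 'I_m) (a : 'I_M.+1) :
  (#|[pred s : {ffun 'I_m -> 'I_M.+1} | s l == a]| * M.+1 = M.+1 ^ m)%N.
Proof.
have -> : #|[pred s : {ffun 'I_m -> 'I_M.+1} | s l == a]| =
   #|family (fun l' => if l' == l then pred1 a else predT)|.
  apply: eq_card => s; rewrite !inE; apply/idP/familyP => [/eqP sl l'|/(_ l)].
    by case: eqP => [->|//]; rewrite inE sl.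
  by rewrite eqxx inE.
rewrite card_family /image_mem foldrE big_map big_enum /= (bigD1 l) //= eqxx card1 mul1n.
rewrite (eq_bigr (fun=> M.+1)); last by move=> l' /negbTE ->; rewrite card_ord.
rewrite prod_nat_const mulnC -expnS; congr (_ ^ _)%N.
rewrite -[RHS](card_ord m) (cardD1 l 'I_m) inE /= add1n; congr _.+1.
by apply: eq_card => l'; rewrite !inE andbT.
Qed.

(** A shift by a 0-1 vector permutes the box if it is taken modulo the side
    length, and the true shift differs from the cyclic one on the last faces
    only; these contain a fraction [m / (M + 1)] of the box. *)
Lemma sum_raise (R : realType) m M (phi : ('I_m -> nat) -> R) (c : 'I_m -> bool) D :
  (forall s, (forall l, (s l <= M.+1)%N) -> `|phi s| <= D) ->
  `|\sum_(s : {ffun 'I_m -> 'I_M.+1}) phi (raise (idx s) c) -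
    \sum_(s : {ffun 'I_m -> 'I_M.+1}) phi (idx s)| * M.+1%:R
  <= 2 * D * m%:R * (M.+1 ^ m)%:R.
Proof.
move=> phiD.
have D0 : 0 <= D by apply: le_trans (phiD (fun=> 0%N) _).
pose wrap (s : {ffun 'I_m -> 'I_M.+1}) : {ffun 'I_m -> 'I_M.+1} :=
  [ffun l => inord ((s l + c l) %% M.+1)].
have wrapE s l : wrap s l = ((s l + c l) %% M.+1)%N :> nat.
  by rewrite ffunE inordK // ltn_mod.
have wrap_inj : injective wrap.
  move=> s t st; apply/ffunP => l; apply/val_inj => /=.
  have := wrapE s l; rewrite st wrapE => /eqP; rewrite eqn_modDr.
  by rewrite !modn_small // => /eqP.
rewrite [X in _ - X](reindex_inj wrap_inj) -sumrB /=.
pose bad l := [pred s : {ffun 'I_m -> 'I_M.+1} | s l == ord_max].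
apply: (@le_trans _ _ ((\sum_(s : {ffun 'I_m -> 'I_M.+1})
   \sum_(l < m) (s \in bad l)%:R * (2 * D)) * M.+1%:R)).
  rewrite ler_wpM2r //; apply: le_trans (ler_norm_sum _ _ _) _.
  apply: ler_sum => s _.
  have [[l sl]|none] := pselect (exists l, s \in bad l).
    rewrite (bigD1 l) //= sl mul1r -[X in X <= _]addr0 lerD //; last first.
      by apply: sumr_ge0 => l' _; rewrite !mulr_ge0.
    apply: le_trans (ler_normB _ _) _; rewrite mulr_natl mulr2n lerD // phiD // => l'.
      rewrite /raise /idx; have := ltn_ord (s l'); case: (c l') => /=; lia.
    by rewrite /idx ltnW // ltnS ltnW // ltnS -ltnS.
  have -> : raise (idx s) c = idx (wrap s).
    apply/funext => l; rewrite /raise /idx wrapE modn_small //.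
    have sM : nat_of_ord (s l) != M.
      by apply/eqP => sM; apply: none; exists l; rewrite inE; apply/eqP/val_inj.
    have := ltn_ord (s l); case: (c l) => /=; lia.
  rewrite subrr normr0; apply: sumr_ge0 => l _; rewrite !mulr_ge0 //.
rewrite exchange_big /= mulr_suml.
rewrite (eq_bigr (fun=> 2 * D * (M.+1 ^ m)%:R)).
  rewrite sumr_const card_ord -mulr_natr le_eqVlt; apply/orP; left; apply/eqP; ring.
move=> l _; rewrite -mulr_suml -natr_sum -(card_face l ord_max) natrM.
have -> : (\sum_(s : {ffun 'I_m -> 'I_M.+1}) (s \in bad l) = #|bad l|)%N.
  by rewrite -sum1_card [RHS]big_mkcond; apply: eq_bigr => s _; case: (s \in bad l).
ring.
Qed.

(** The reflection of the box pairs the coordinate [s l] with [M - s l]. *)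
Lemma sum_linear_box (R : realType) m M (a : 'I_m -> R) :
  2 * \sum_(s : {ffun 'I_m -> 'I_M.+1}) \sum_l (s l)%:R * a l =
  (M.+1 ^ m)%:R * M%:R * \sum_l a l.
Proof.
pose rev (s : {ffun 'I_m -> 'I_M.+1}) : {ffun 'I_m -> 'I_M.+1} :=
  [ffun l => rev_ord (s l)].
have rev_inj : injective rev.
  by apply: inv_inj => s; apply/ffunP => l; rewrite !ffunE rev_ordK.
rewrite mulr_natl mulr2n [X in X + _](reindex_inj rev_inj) -big_split /=.
rewrite (eq_bigr (fun=> M%:R * \sum_l a l)).
  rewrite sumr_const card_ffun !card_ord -mulr_natl; ring.
move=> s _; rewrite -big_split mulr_sumr /=; apply: eq_bigr => l _.
rewrite -mulrDl -natrD ffunE /=; congr (_%:R * _).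
have := ltn_ord (s l); lia.
Qed.

(** The averages of [g e] over growing boxes, in units of the average of [S],
    which is of the order of the side length.  The shifts [~~ b i l] of the
    scales change such an average by a bounded amount, as do the error terms of
    the hypothesis; so both vanish in the limit, which is taken along an
    ultrafilter because nothing ensures convergence.  The lower bound on the
    solution comes from the upper bound on [g]. *)
Lemma averaged_solution (R : realType) m d (b : 'I_d -> 'I_m -> bool)
    (rho : ('I_m -> nat) -> R) (a : 'I_m -> R)
    (g : ('I_m -> nat) -> ('I_m -> nat) -> R) :
  let S s := \sum_l (s l)%:R * a l in
  (forall l, 0 <= a l) -> 0 < \sum_l a l ->
  (forall e, exists C, forall s, `|g e s| <= C * (1 + S s)) ->
  (forall e, exists C, forall s, g e s <= S s + C) ->
  (forall e, exists C, forall s,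
    `|\sum_(i < d) g (lower e (b i)) (raise s (fun l => ~~ b i l)) + rho e * S s|
    <= C) ->
  exists f : ('I_m -> nat) -> R, (forall e, -1 <= f e) /\
    forall e, \sum_(i < d) f (lower e (b i)) = rho e.
Proof.
move=> S a0 sig0 gbnd gup geq; set sig := \sum_l a l in sig0.
have S0 s : 0 <= S s by apply: sumr_ge0 => l _; rewrite mulr_ge0.
pose box n := {ffun 'I_m -> 'I_n.+2}.
pose N n : R := \sum_(s : box n) S (idx s).
pose V n : R := (n.+2 ^ m)%:R.
have V_gt0 n : 0 < V n by rewrite /V ltr0n expn_gt0.
have NE n : N n = V n * n.+1%:R * sig / 2.
  have : 2 * N n = V n * n.+1%:R * sig := sum_linear_box n.+1 a; lra.
have N_gt0 n : 0 < N n by rewrite NE divr_gt0 // !mulr_gt0.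
(* The box is small compared with the normalisation. *)
have VN n : V n = N n * (2 / sig * harmonic n).
  rewrite NE /harmonic /=; field.
  by rewrite nat1r pnatr_eq0 (gt_eqF sig0).
have harm1 n : 2 / sig * harmonic n <= 2 / sig :> R.
  by rewrite ler_piMr ?divr_ge0 ?(ltW sig0) //= invf_le1 // ler1n.
pose u e n : R := - (\sum_(s : box n) g e (idx s)) / N n.
have [U [UP subU Ulim]] := ultrafilter_limits R.
have harm_cvg : (fun n => 2 / sig * harmonic n : R) @ U --> (0 : R).
  rewrite -(mulr0 (2 / sig)); apply: cvgMr.
  apply: cvg_trans (@cvg_harmonic R).
  by apply: cvg_app; exact: subU.
have sum1E n : \sum_(s : box n) (1 : R) = V n.
  by rewrite sumr_const card_ffun !card_ord /V.
have ubnd e : exists C : R, forall n, `|u e n| <= C.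
  have [C gC] := gbnd e; exists (C * (2 / sig + 1)) => n.
  have C0 : 0 <= C by move: (gC (fun=> 0%N)) (S0 (fun=> 0%N)); have := normr_ge0 (g e (fun=> 0%N)); nra.
  rewrite normrM normrN normfV (gtr0_norm (N_gt0 n)) ler_pdivrMr //.
  apply: le_trans (ler_norm_sum _ _ _) _.
  apply: (@le_trans _ _ (\sum_(s : box n) C * (1 + S (idx s)))); first exact: ler_sum.
  rewrite -mulr_sumr big_split /= sum1E -/(N n) -mulrA ler_wpM2l //.
  have : V n <= 2 / sig * N n by rewrite VN mulrC ler_wpM2r // ltW.
  by move=> leVN; rewrite [leRHS]mulrDl mul1r lerD2r.
pose f e := get [set l : R | u e n @[n --> U] --> l].
have fcvg e : u e @ U --> f e.
  have [C /Ulim[l ul]] := ubnd e.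
  by rewrite /f; apply: (@getPex _ [set l : R | u e n @[n --> U] --> l]); exists l.
exists f; split=> e.
  have [C gC] := gup e.
  have low n : -1 - C * (2 / sig * harmonic n) <= u e n.
    rewrite /u ler_pdivlMr // -lerN2 opprK.
    apply: (@le_trans _ _ (\sum_(s : box n) (S (idx s) + C * 1))); first by apply: ler_sum => s _; rewrite mulr1.
    rewrite big_split /= -mulr_sumr sum1E VN -/(N n).
    have -> : harmonic n = n.+1%:R^-1 :> R by [].
    by rewrite le_eqVlt; apply/orP; left; apply/eqP; ring.
  have lim_low : (fun n => u e n + C * (2 / sig * harmonic n)) @ U --> f e.
    rewrite -[f e]addr0 -(mulr0 C); apply: cvgD (fcvg e) _.
    exact: cvgMr harm_cvg.
  apply: cvgr_to_ge lim_low _; apply: (@filterS _ U _ setT) => [n _|].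
    by rewrite -lerBlDr.
  exact: filterT.
have [C geC] := geq e.
have /choice[D gD] : forall i, exists C, forall s, `|g (lower e (b i)) s| <= C * (1 + S s).
  by move=> i; exact: gbnd.
pose D' := \sum_i `|D i|.
have DD' i : D i <= D'.
  rewrite /D' (bigD1 i) //= (le_trans (ler_norm _)) // lerDl.
  exact: sumr_ge0.
pose K := C + d%:R * (2 * D' * (1 + sig) * m%:R).
have close n : `|\sum_(i < d) u (lower e (b i)) n - rho e| <= K * (2 / sig * harmonic n).
  rewrite -(ler_pM2l (N_gt0 n)) mulrCA -VN -[X in X * `|_|](gtr0_norm (N_gt0 n)) -normrM.
  have -> : N n * (\sum_(i < d) u (lower e (b i)) n - rho e) =
     \sum_(i < d) (\sum_(s : box n) g (lower e (b i)) (raise (idx s) (fun l => ~~ b i l))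
        - \sum_(s : box n) g (lower e (b i)) (idx s))
     - \sum_(s : box n) (\sum_(i < d) g (lower e (b i)) (raise (idx s) (fun l => ~~ b i l))
        + rho e * S (idx s)).
    rewrite sumrB [X in _ = _ - X]big_split /= -mulr_sumr -/(N n).
    rewrite [X in _ = _ - (X + _)]exchange_big /=.
    rewrite mulrBr mulr_sumr (eq_bigr (fun i => - \sum_(s : box n) g (lower e (b i)) (idx s))).
      by rewrite sumrN; ring.
    by move=> i _; rewrite /u mulrCA mulfV ?gt_eqF // mulr1.
  apply: le_trans (ler_normB _ _) _; rewrite [leRHS]mulrDl [leRHS]addrC lerD //; last first.
    apply: le_trans (ler_norm_sum _ _ _) _.
    apply: (@le_trans _ _ (\sum_(s : box n) C * 1)); first by apply: ler_sum => s _; rewrite mulr1.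
    by rewrite sumr_const card_ffun !card_ord mulr1 -mulr_natr.
  apply: le_trans (ler_norm_sum _ _ _) _.
  apply: (@le_trans _ _ (\sum_(i < d) 2 * D' * (1 + sig) * m%:R * V n)); last first.
    by rewrite sumr_const card_ord -[X in X <= _]mulr_natl mulrA.
  apply: ler_sum => i _.
  rewrite -(ler_pM2r (ltr0Sn R n.+1)).
  apply: le_trans (@sum_raise R m n.+1 (g (lower e (b i))) _ (D' * (1 + n.+2%:R * sig)) _) _.
    move=> s sle; apply: le_trans (gD i s) _; rewrite ler_pM ?addr_ge0 //.
      by have := gD i s; have := S0 s; have := normr_ge0 (g (lower e (b i)) s); nra.
    rewrite lerD2l /S /sig mulr_sumr; apply: ler_sum => l _.
    by rewrite ler_wpM2r // ler_nat.
  rewrite -/(V n).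
  have -> : 2 * D' * (1 + sig) * m%:R * V n * n.+2%:R = 2 * (D' * ((1 + sig) * n.+2%:R)) * m%:R * V n by ring.
  have D'0 : 0 <= D' by exact: sumr_ge0.
  rewrite ler_pM2r // ler_wpM2r // ler_wpM2l // ler_wpM2l //.
  have : 1 <= n.+2%:R :> R by rewrite ler1n.
  lra.
have lim1 : (fun n => \sum_(i < d) u (lower e (b i)) n) @ U --> \sum_(i < d) f (lower e (b i)).
  apply: (@cvg_big _ _ _ _ _ (add_continuous)) => // i _; exact: fcvg.
have lim2 : (fun n => \sum_(i < d) u (lower e (b i)) n) @ U --> rho e.
  apply/cvgrPdist_le => eps eps0.
  have limK : (fun n => K * (2 / sig * harmonic n)) @ U --> (0 : R).
    by rewrite -(mulr0 K); exact: cvgMr harm_cvg.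
  move/cvgr0Pnorm_le : limK => /(_ eps eps0).
  apply: filterS => n; rewrite distrC; apply: le_trans.
  exact: le_trans (close n) (ler_norm _).
exact: (cvg_unique _ lim1 lim2).
Qed.

End Averaging.

(** * Roots of unity *)

Section RootsOfUnity.
Import Order.TTheory GRing.Theory Num.Theory.
Local Open Scope ring_scope.

(** A root of unity is primitive of one order only. *)
Lemma prim_root_order_bound (F : fieldType) (rs : seq F) :
  exists B, forall n z, z \in rs -> n.-primitive_root z -> (n <= B)%N.
Proof.
elim: rs => [|r rs [B BP]]; first by exists 0%N.
have [[n0 prim0]|none] := pselect (exists n, n.-primitive_root r).
  exists (maxn n0 B) => n z; rewrite inE => /orP[/eqP ->|zrs] prim_z.
    rewrite leq_max; apply/orP; left; apply: dvdn_leq.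
      exact: prim_order_gt0 prim0.
    by rewrite (prim_order_dvd prim_z) prim_expr_order.
  by rewrite leq_max (BP n z) ?orbT.
exists B => n z; rewrite inE => /orP[/eqP ->|zrs] prim_z; last exact: BP prim_z.
by case: none; exists n.
Qed.

Variable F : numClosedFieldType.
Implicit Types (z w : F) (n q a A : nat).

Lemma prim_root_exists n : (0 < n)%N -> exists z, n.-primitive_root z.
Proof.
pose p : {poly F} := 'X^n - 1; have [r Dp] := closed_field_poly_normal p.
move=> n_gt0; rewrite (monicP _) ?monicXnsubC // scale1r in Dp.
have rn1 : all n.-unity_root r by apply/allP=> z; rewrite -root_prod_XsubC -Dp.
have sz_r : (n < (size r).+1)%N.
  by rewrite -(size_prod_XsubC r id) -Dp size_XnsubC.
have [|z] := hasP (has_prim_root n_gt0 rn1 _ sz_r); last by exists z.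
by rewrite -separable_prod_XsubC -Dp separable_Xn_sub_1 // pnatr_eq0 -lt0n.
Qed.

(** The order [D] of [w] satisfies [D / gcd (q, D) = q ^ a]; for [0 < a] this makes
    [q] a divisor of [D], so that the gcd is [q]. *)
Lemma prim_root_lift q a z w : (0 < a)%N ->
  (q ^ a).-primitive_root z -> w ^+ q = z -> (q ^ a.+1).-primitive_root w.
Proof.
move=> a_gt0 prim_z wz.
have qa_gt0 : (0 < q ^ a)%N := prim_order_gt0 prim_z.
have q_gt0 : (0 < q)%N by move: qa_gt0; rewrite expn_gt0; case/orP => // /eqP a0; lia.
have qa1_gt0 : (0 < q ^ a.+1)%N by rewrite expn_gt0 q_gt0.
have [|D prim_w dvD] := @prim_order_exists F (q ^ a.+1) w qa1_gt0.
  by rewrite expnS exprM wz prim_expr_order.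
have prim_wq := exp_prim_root prim_w q; rewrite wz in prim_wq.
have eqD : (D %/ gcdn q D = q ^ a)%N.
  by apply/eqP; rewrite eqn_dvd (prim_order_dvd prim_wq) prim_expr_order //
    (prim_order_dvd prim_z) prim_expr_order // eqxx.
have DE : D = (q ^ a * gcdn q D)%N by rewrite -eqD divnK // dvdn_gcdr.
have qD : (q %| D)%N by rewrite DE dvdn_mulr // -(prednK a_gt0) expnS dvdn_mulr.
by move: DE; rewrite (gcdn_idPl qD) -expnSr => <-.
Qed.

Lemma coherent_roots q : (0 < q)%N ->
  exists om : nat -> F, [/\ om 0%N = 1, forall a, (q ^ a).-primitive_root (om a) &
    forall a, om a.+1 ^+ q = om a].
Proof.
move=> q_gt0; have [z prim_z] := prim_root_exists q_gt0.
pose om a := if a is a'.+1 then iter a' (fun w => q.-root w) z else 1.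
have omS a : om a.+1 ^+ q = om a.
  by case: a => [|a] /=; [exact: prim_expr_order|rewrite rootCK].
exists om; split=> //; elim=> [|[|a] IH] //=.
- by apply/andP; split=> //; apply/forallP => i; rewrite ord1 unity_rootE expr1n !eqxx.
- exact: prim_root_lift IH (omS _).
Qed.

(** Raising to the power [A] is a bijection of the [n]-th roots of unity, with
    inverse given by the exponent [A ^ (totient n - 1)] of the theorem of
    Euler. *)
Lemma coprime_root n A w : (0 < n)%N -> coprime A n -> w ^+ n = 1 ->
  exists2 z, z ^+ A = w & z ^+ n = 1.
Proof.
move=> n_gt0 co wn1.
exists (w ^+ (A ^ (totient n).-1)); last by rewrite exprAC wn1 expr1n.
have tn : (0 < totient n)%N by rewrite totient_gt0.
rewrite -exprM -expnSr prednK // -(expr_mod _ wn1) Euler_exp_totient //.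
by rewrite (expr_mod _ wn1).
Qed.

Lemma coprime_expr_inj n A z w : (0 < n)%N -> coprime A n ->
  z ^+ n = 1 -> w ^+ n = 1 -> z ^+ A = w ^+ A -> z = w.
Proof.
move=> n_gt0 co zn wn zw.
have K (x : F) : x ^+ n = 1 -> x ^+ A ^+ (A ^ (totient n).-1) = x.
  move=> xn; have tn : (0 < totient n)%N by rewrite totient_gt0.
  by rewrite -exprM -expnS prednK // -(expr_mod _ xn) Euler_exp_totient // (expr_mod _ xn).
by rewrite -(K z) // zw K.
Qed.

Lemma prim_root_of_power n A z w : n.-primitive_root w -> z ^+ A = w -> z ^+ n = 1 ->
  n.-primitive_root z.
Proof.
move=> prim_w zA zn; have n_gt0 := prim_order_gt0 prim_w.
have [D prim_z dvD] := prim_order_exists n_gt0 zn.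
suff -> : n = D by [].
apply/eqP; rewrite eqn_dvd dvD andbT (prim_order_dvd prim_w) -zA exprAC.
by rewrite (prim_expr_order prim_z) expr1n.
Qed.

(** If the product has order [D], raising it to [D] times the other [n j]
    isolates the factor [z i]. *)
Lemma prim_root_prod m (n : 'I_m -> nat) (z : 'I_m -> F) :
  (forall i j, i != j -> coprime (n i) (n j)) ->
  (forall i, (n i).-primitive_root (z i)) ->
  (\prod_i n i).-primitive_root (\prod_i z i).
Proof.
move=> co prim; have n_gt0 i : (0 < n i)%N := prim_order_gt0 (prim i).
have N_gt0 : (0 < \prod_i n i)%N by rewrite prodn_gt0.
have zN i N : (n i %| N)%N -> z i ^+ N = 1.
  by move=> dv; apply/eqP; rewrite -(prim_order_dvd (prim i)).
have [|D prim_z dvD] := @prim_order_exists F _ (\prod_i z i) N_gt0.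
  by rewrite -prodrXl big1 // => i _; rewrite zN // (bigD1 i) //= dvdn_mulr.
suff -> : (\prod_i n i)%N = D by [].
apply/eqP; rewrite eqn_dvd dvD andbT.
have dv i : (n i %| D)%N.
  pose N := (\prod_(j | j != i) n j)%N.
  have coN : coprime (n i) N.
    apply: (big_ind (coprime (n i))); first exact: coprimen1.
      by move=> x y co_x co_y; rewrite coprimeMr co_x.
    by move=> j ji; rewrite co // eq_sym.
  rewrite -(Gauss_dvdr _ coN) (prim_order_dvd (prim i)); apply/eqP.
  have := congr1 (fun x => x ^+ N) (prim_expr_order prim_z).
  rewrite expr1n -prodrXl -prodrXl (bigD1 i) //= [X in _ * X]big1.
    by rewrite mulr1 -exprM mulnC.
  by move=> j ji; rewrite -exprM zN // mulnC /N (bigD1 j) //= -mulnA dvdn_mulr.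
have : forall r, uniq r -> (\prod_(i <- r) n i %| D)%N.
  elim=> [|i r IH] /=; first by rewrite big_nil.
  move=> /andP[ir ur]; rewrite big_cons Gauss_dvd ?dv ?IH //.
  rewrite big_seq; apply: (big_ind (coprime (n i))); first exact: coprimen1.
    by move=> x y co_x co_y; rewrite coprimeMr co_x.
  by move=> j jr; apply: co; apply: contraNneq ir => ->.
by move/(_ (index_enum _) (index_enum_uniq _)).
Qed.

(** [z] is a root of the factor ['Phi_d] of ['X^n - 1] for some [d] dividing [n],
    and then [z ^+ d = 1] forces [d = n]. *)
Lemma root_Cyclotomic_prim n z : n.-primitive_root z ->
  root (map_poly intr 'Phi_n) z.
Proof.
move=> prim_z; have n_gt0 := prim_order_gt0 prim_z.
have := congr1 (fun p => (map_poly (intr : int -> F) p).[z]) (prod_Cyclotomic n_gt0).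
rewrite rmorphB rmorph1 rmorph_prod /= map_polyXn !hornerE prim_expr_order // subrr.
rewrite horner_prod => /eqP; rewrite prodf_seq_eq0 => /hasP[d].
rewrite -dvdn_divisors //= => dv root_d.
have d_gt0 : (0 < d)%N by rewrite (dvdn_gt0 n_gt0).
suff -> : n = d by [].
apply/eqP; rewrite eqn_dvd dv andbT (prim_order_dvd prim_z).
have := congr1 (fun p => (map_poly (intr : int -> F) p).[z]) (prod_Cyclotomic d_gt0).
rewrite (bigD1_seq d) ?divisors_uniq -?dvdn_divisors //= rmorphM hornerM (eqP root_d) mul0r.
by rewrite rmorphB rmorph1 /= map_polyXn !hornerE => /esym/eqP; rewrite subr_eq0.
Qed.

Lemma simple_root_Cyclotomic n z : n.-primitive_root z ->
  exists2 h, map_poly intr 'Phi_n = ('X - z%:P) * h & ~~ root h z.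
Proof.
move=> prim_z; have n_gt0 := prim_order_gt0 prim_z.
have /factor_theorem[h hE] := root_Cyclotomic_prim prim_z.
exists h; first by rewrite mulrC.
have : separable_poly (map_poly (intr : int -> F) 'Phi_n).
  have := @separable_Xn_sub_1 F n; rewrite pnatr_eq0 -lt0n => /(_ n_gt0).
  apply: dvdp_separable.
  have := congr1 (map_poly (intr : int -> F)) (prod_Cyclotomic n_gt0).
  rewrite rmorphB rmorph1 /= map_polyXn => <-.
  by rewrite (bigD1_seq n) ?divisors_uniq -?dvdn_divisors //= rmorphM dvdp_mulr.
by rewrite hE separable_root => /andP[].
Qed.

(** All primitive [n]-th roots of unity are roots of an integer polynomial with
    the same multiplicity: ['Phi_n] is irreducible over the rationals, hence can
    be divided out as long as it is not coprime to the polynomial, and its roots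
    are simple.  Irreducibility is read off the minimal polynomial of a root of
    unity among the algebraic numbers; the roots here live in an arbitrary field
    [F], to which coprimality is transported by a Bezout relation. *)
Lemma prim_root_multiplicity n (p : {poly int}) : (0 < n)%N -> p != 0 ->
  exists a, forall z, n.-primitive_root z ->
    exists2 h, map_poly intr p = ('X - z%:P) ^+ a * h & ~~ root h z.
Proof.
move=> n_gt0 p_neq0.
have [x prim_x] := C_prim_root_exists n_gt0.
have [q [Dq mon_q] dv_q] := minCpolyP x.
have qE : q = map_poly intr 'Phi_n.
  apply: (map_inj_poly (fmorph_inj (ratr : rat -> algC))); first exact: rmorph0.
  rewrite -Dq (minCpoly_cyclotomic prim_x) -(Cintr_Cyclotomic prim_x) -map_poly_comp.
  by apply: eq_map_poly => c /=; rewrite ratr_int.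
have q_root : root (map_poly ratr q) x by rewrite dv_q.
have q_irr r : ~~ (q %| r) -> coprimep q r.
  move=> qr; rewrite coprimep_def; set g := gcdp q r.
  have /dvdpP[h hE] : g %| q by exact: dvdp_gcdl.
  have q0 : q != 0 by exact: monic_neq0.
  have : root (map_poly (ratr : rat -> algC) (h * g)) x by rewrite -hE.
  rewrite rmorphM rootM !dv_q => /orP[qh|qg]; last first.
    by case/negP: qr; apply: dvdp_trans qg (dvdp_gcdr _ _).
  move: q0; rewrite hE mulf_eq0 negb_or => /andP[h0 g0].
  have := dvdp_leq h0 qh; rewrite hE size_mul //.
  have : (0 < size g)%N by rewrite size_poly_gt0.
  have : (0 < size h)%N by rewrite size_poly_gt0.
  by move=> ? ? ?; rewrite eqn_leq; lia.
have ratP : forall N (r : {poly rat}), (size r <= N)%N -> r != 0 ->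
  exists a, forall z, n.-primitive_root z ->
    exists2 h, map_poly ratr r = ('X - z%:P) ^+ a * h & ~~ root h z.
  elim=> [r|N IH r leN r0]; first by rewrite leqn0 size_poly_eq0 => ->.
  have qF z : map_poly (ratr : rat -> F) q = map_poly intr 'Phi_n.
    by rewrite qE -map_poly_comp; apply: eq_map_poly => c /=; rewrite ratr_int.
  have [qr|qr] := boolP (q %| r); last first.
    exists 0%N => z prim_z; exists (map_poly ratr r); first by rewrite mul1r.
    have := q_irr _ qr; rewrite -(coprimep_map (ratr : {rmorphism rat -> F})).
    move/coprimep_root; apply; rewrite (qF z) //; exact: root_Cyclotomic_prim.
  have /dvdpP[r' rE] := qr; move: (r0); rewrite rE mulf_eq0 negb_or => /andP[r'0 q0].
  have size_q : (1 < size q)%N.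
    rewrite ltnNge; apply/negP => /size1_polyC qc; move: q_root.
    by rewrite qc map_polyC rootC fmorph_eq0 -polyC_eq0 -qc (negbTE q0).
  have le_r' : (size r' <= N)%N.
    move: leN size_q; rewrite rE size_mul //; set x1 := size r'; set x2 := size q.
    by clear; lia.
  have [a aP] := IH r' le_r' r'0.
  exists a.+1 => z prim_z; have [h hE hz] := aP z prim_z.
  have [h' h'E h'z] := simple_root_Cyclotomic prim_z.
  exists (h * h'); last by rewrite rootM negb_or hz.
  by rewrite rmorphM /= hE (qF z) h'E exprSr; ring.
have [|a aP] := ratP _ (map_poly intr p) (leqnn _).
  by rewrite map_poly_eq0_id0 // intr_eq0 lead_coef_eq0.
exists a => z /aP[h hE hz]; exists h => //; rewrite -hE -map_poly_comp.
by apply: eq_map_poly => c /=; rewrite ratr_int.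
Qed.

End RootsOfUnity.

(** * Compatible phases *)

Section Phases.
Import Order.TTheory GRing.Theory Num.Theory.
Local Open Scope ring_scope.

(** The argument [th e s] is a product over [l] of roots of unity of order
    [q l ^ e l].  The power [q l] lowers [e l] by one along a coherent system of
    roots [om l], but it also acts on the [l']-th factor, for [l' != l], by a
    permutation of the roots of unity of the same order.  The scale [s] records
    these permutations: the [l]-th factor is the unique root of unity of
    order [q l ^ e l] whose power of exponent [\prod_(l' | l' != l) q l' ^ s l']
    is [om l (e l)], so that a power of [q l'] is compensated by lowering
    [s l']. *)
Lemma phase_system (F : numClosedFieldType) m (q : 'I_m -> nat) :
  (forall l, 0 < q l)%N -> (forall j l, j != l -> coprime (q j) (q l)) ->
  exists th : ('I_m -> nat) -> ('I_m -> nat) -> F,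
    (forall e s, (\prod_l q l ^ e l)%N.-primitive_root (th e s)) /\
    forall e s (b : 'I_m -> bool),
      th e (raise s b) ^+ (\prod_l q l ^ b l)%N = th (lower e b) s.
Proof.
move=> q_gt0 co.
have /choice[om omP] := fun l => @coherent_roots F (q l) (q_gt0 l).
pose A l (s : 'I_m -> nat) := (\prod_(l' | l' != l) q l' ^ s l')%N.
have coA l s a : coprime (A l s) (q l ^ a).
  apply: coprimeXr; rewrite coprime_sym; apply: (big_ind (coprime (q l))).
  - exact: coprimen1.
  - by move=> x y co_x co_y; rewrite coprimeMr co_x.
  - by move=> l' l'l; rewrite coprimeXr // co // eq_sym.
have qa_gt0 l a : (0 < q l ^ a)%N by rewrite expn_gt0 q_gt0.
have /choice[ph phP] : forall x : 'I_m * nat * ('I_m -> nat), exists z : F,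
    z ^+ A x.1.1 x.2 = om x.1.1 x.1.2 /\ z ^+ (q x.1.1 ^ x.1.2) = 1.
  move=> [[l a] s] /=; have [_ prim_om _] := omP l.
  have [z zA zq] := coprime_root (qa_gt0 l a) (coA l s a) (prim_expr_order (prim_om a)).
  by exists z.
pose th e s := \prod_l ph (l, e l, s).
exists th; split=> [e s|e s b].
  apply: prim_root_prod => [i j ij|l]; first by rewrite coprimeXl // coprimeXr // co.
  have [_ prim_om _] := omP l; have [/= zA zq] := phP (l, e l, s).
  exact: prim_root_of_power (prim_om (e l)) zA zq.
rewrite /th -prodrXl; apply: eq_bigr => l _.
have [om0 _ omS] := omP l.
have [/= zA zq] := phP (l, e l, raise s b); set z := ph _ in zA zq *.
have [/= wA wq] := phP (l, lower e b l, s); set w := ph (l, lower e b l, s) in wA wq *.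
rewrite (bigD1 l) //=; set kap := (\prod_(i | i != l) _)%N.
(* Both sides are roots of unity with the same power of exponent A l s. *)
apply: (coprime_expr_inj (qa_gt0 l (lower e b l)) (coA l s _)) => //.
  have -> : (z ^+ (q l ^ b l * kap)%N) ^+ (q l ^ lower e b l)%N =
      (z ^+ (q l ^ e l)) ^+ (q l ^ (b l + lower e b l - e l) * kap).
    rewrite -!exprM; congr (_ ^+ _).
    rewrite [RHS]mulnA -expnD mulnAC -expnD /lower; congr (_ ^ _ * _)%N; lia.
  by rewrite zq expr1n.
rewrite wA -exprM.
have -> : (q l ^ b l * kap * A l s = A l (raise s b) * q l ^ b l)%N.
  have -> : A l (raise s b) = (A l s * kap)%N.
    by rewrite -big_split; apply: eq_bigr => l' _; rewrite /raise expnD.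
  by rewrite -mulnA mulnC [(kap * _)%N]mulnC.
rewrite exprM zA /lower; case: (b l); last by rewrite expn0 expr1 subn0.
case: (e l) => [|a]; first by rewrite om0 expr1n.
by rewrite expn1 omS subn1.
Qed.

End Phases.

(** * Growth of a polynomial near a root of unity *)

Section LocalGrowth.
Import Order.TTheory GRing.Theory Num.Theory.
Import ComplexField.
Local Open Scope ring_scope.
Local Open Scope complex_scope.

Variable R : realType.
Implicit Types (z zeta : R[i]) (t tau : R).

(** The norm of [R[i]] takes its values in [R[i]]; the logarithm needs a real
    number. *)
Definition cabs z : R := Normc.normc z.

Lemma cabsM z w : cabs (z * w) = cabs z * cabs w.
Proof. exact: Normc.normcM. Qed.

Lemma cabs1 : cabs 1 = 1. Proof. exact: Normc.normc1. Qed.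

Lemma cabs0 : cabs 0 = 0. Proof. exact: Normc.normc0. Qed.

Lemma cabs_ge0 z : 0 <= cabs z.
Proof. by case: z => a b; exact: sqrtr_ge0. Qed.

Lemma cabs_eq0 z : (cabs z == 0) = (z == 0).
Proof. by apply/eqP/eqP => [/Normc.eq0_normc//|->]; exact: cabs0. Qed.

Lemma cabs_gt0 z : (0 < cabs z) = (z != 0).
Proof. by rewrite lt_def cabs_eq0 cabs_ge0 andbT. Qed.

Lemma cabsX z n : cabs (z ^+ n) = cabs z ^+ n.
Proof. by elim: n => [|n IH]; rewrite ?cabs1 // !exprS cabsM IH. Qed.

Lemma cabs_prod I (r : seq I) (P : pred I) (f : I -> R[i]) :
  cabs (\prod_(i <- r | P i) f i) = \prod_(i <- r | P i) cabs (f i).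
Proof. exact: (big_morph _ cabsM cabs1). Qed.

Lemma cabsD z w : cabs (z + w) <= cabs z + cabs w.
Proof. exact: le_normcD. Qed.

Lemma cabsN z : cabs (- z) = cabs z.
Proof. exact: normcN. Qed.

Lemma cabsB z w : cabs (z - w) = cabs (w - z).
Proof. by rewrite -cabsN opprB. Qed.

Lemma cabs_sum I (r : seq I) (P : pred I) (f : I -> R[i]) :
  cabs (\sum_(i <- r | P i) f i) <= \sum_(i <- r | P i) cabs (f i).
Proof.
elim/big_rec2: _ => [|i x y _ IH]; first by rewrite cabs0.
by apply: le_trans (cabsD _ _) _; rewrite lerD2l.
Qed.

Lemma cabs_dist z w : `|cabs z - cabs w| <= cabs (z - w).
Proof.
have H x y : cabs x - cabs y <= cabs (x - y).
  by rewrite lerBlDr -{1}(subrK y x) cabsD.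
by rewrite ler_norml H lerNl opprB cabsB H.
Qed.

Lemma cabs_real (x : R) : cabs x%:C = `|x|.
Proof. by rewrite /cabs /= expr0n /= addr0 sqrtr_sqr. Qed.

Lemma cabs_root_unity n z : (0 < n)%N -> z ^+ n = 1 -> cabs z = 1.
Proof.
move=> n_gt0 zn; apply: (pexpIrn n_gt0); rewrite ?nnegrE ?cabs_ge0 //.
by rewrite -cabsX zn cabs1 expr1n.
Qed.

Lemma cabs_polar t zeta : cabs zeta = 1 -> cabs ((expR t)%:C * zeta) = expR t.
Proof. by move=> z1; rewrite cabsM z1 mulr1 cabs_real gtr0_norm ?expR_gt0. Qed.

Lemma one_minus_expRN t : 0 < t -> t <= 1 -> t / 2 <= 1 - expR (- t) <= t.
Proof.
move=> t0 t1; have le1 := expR_ge1Dx (- t); have le2 := expR_ge1Dx t.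
have E : expR t * expR (- t) = 1 by rewrite expRN mulfV // gt_eqF ?expR_gt0.
have pos := expR_gt0 (- t).
have le3 : expR (- t) * (1 + t) <= 1 by nra.
apply/andP; split; [nra | lra].
Qed.

Lemma ln_bounds (c C x : R) : 0 < c -> c <= x -> x <= C -> `|ln x| <= `|ln c| + `|ln C|.
Proof.
move=> c0 cx xC; have x0 : 0 < x by exact: lt_le_trans cx.
have C0 : 0 < C by exact: lt_le_trans xC.
have : ln c <= ln x by rewrite ler_ln.
have : ln x <= ln C by rewrite ler_ln.
move: (ln c) (ln C) (ln x) => a b y yb ay.
have := ler_norm b; have := ler_norm (- a); rewrite normrN.
have := normr_ge0 a; have := normr_ge0 b.
by move=> *; rewrite ler_norml; apply/andP; split; lra.
Qed.

(** The radii that are used lie in an annulus near the unit circle containing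
    none of the finitely many roots of modulus less than 1. *)
Lemma root_gap (rs : seq R[i]) : exists tau, [/\ 0 < tau, tau <= 1 &
  forall r, r \in rs -> cabs r < 1 -> cabs r < expR (- tau)].
Proof.
elim: rs => [|r rs [tau [tau0 tau1 H]]]; first by exists 1; split.
have [r1|r1] := ltP (cabs r) 1; last first.
  exists tau; split=> // w; rewrite inE => /orP[/eqP ->|]; last exact: H.
  by rewrite ltNge r1.
pose tau' := Num.min tau ((1 - cabs r) / 2).
have tau'0 : 0 < tau' by rewrite lt_min tau0 /= divr_gt0 // subr_gt0.
exists tau'; split=> //; first by rewrite ge_min tau1.
move=> w; rewrite inE => /orP[/eqP -> _|wrs w1].
  apply: lt_le_trans (expR_ge1Dx _).
  have : tau' <= (1 - cabs r) / 2 by rewrite ge_min lexx orbT.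
  lra.
apply: lt_le_trans (H w wrs w1) _; rewrite ler_expR lerN2 ge_min lexx //.
Qed.

(** Each linear factor is bounded below on the radius ending at [zeta].  For a
    root [r] inside the disc this is the gap of the annulus; for a root with
    [1 <= cabs r], the distance from [z] to [r] is at least the distance from [z]
    to the unit circle, that is to [zeta], hence at least half of the distance
    from [zeta] to [r]. *)
Lemma horner_away_from_roots (G : {poly R[i]}) tau zeta :
  cabs zeta = 1 -> ~~ root G zeta ->
  (forall r, root G r -> cabs r < 1 -> cabs r < expR (- tau)) ->
  exists c C, 0 < c /\ forall t, 0 < t -> t <= tau ->
    c <= cabs G.[(expR (- t))%:C * zeta] <= C.
Proof.
move=> zeta1 Gzeta gap; have [rs GE] := closed_field_poly_normal G.
have lc0 : lead_coef G != 0 by rewrite lead_coef_eq0; apply: contraNneq Gzeta => ->; rewrite root0.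
have rootE r : root G r = (r \in rs) by rewrite GE rootZ // root_prod_XsubC.
have main (s : seq R[i]) : {subset s <= rs} ->
    exists c C, 0 < c /\ forall t, 0 < t -> t <= tau ->
      c <= cabs (\prod_(r <- s) ('X - r%:P)).[(expR (- t))%:C * zeta] <= C.
  elim: s => [_|r s IH sub].
    exists 1, 1; split => // t _ _; rewrite big_nil hornerC cabs1 lexx //.
  have [|c [C [c0 cC]]] := IH _; first by move=> x xs; apply: sub; rewrite inE xs orbT.
  have r_rs : root G r by rewrite rootE sub // inE eqxx.
  have [c' [c'0 c'P]] : exists c', 0 < c' /\ forall t, 0 < t -> t <= tau ->
      c' <= cabs ((expR (- t))%:C * zeta - r).
    have [r1|r1] := ltP (cabs r) 1.
      exists (expR (- tau) - cabs r); split; first by rewrite subr_gt0 gap.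
      move=> t t0 tt; apply: (@le_trans _ _ (expR (- t) - cabs r)).
        by rewrite lerD2r ler_expR lerN2.
      have := cabs_dist ((expR (- t))%:C * zeta) r; rewrite cabs_polar //.
      by apply: le_trans; exact: ler_norm.
    exists (cabs (zeta - r) / 2); split.
      rewrite divr_gt0 // cabs_gt0 subr_eq0; apply: contraNneq Gzeta => ->.
      by rewrite r_rs.
    move=> t t0 tt; set z := _ * zeta.
    have e1 : expR (- t) < 1 by rewrite expR_lt1 oppr_lt0.
    have d1 : cabs (zeta - z) = 1 - expR (- t).
      have -> : zeta - z = (1 - expR (- t))%:C * zeta.
        by rewrite /z rmorphB rmorph1 mulrBl mul1r.
      by rewrite cabsM zeta1 mulr1 cabs_real ger0_norm // subr_ge0 ltW.
    have d2 : 1 - expR (- t) <= cabs (z - r).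
      have := cabs_dist z r; rewrite /z cabs_polar // -/z.
      by have := ler_norm (cabs r - expR (- t)); rewrite distrC; lra.
    have := cabsD (zeta - z) (z - r); rewrite addrA subrK; lra.
  exists (c' * c), ((1 + cabs r) * C); split; first by rewrite mulr_gt0.
  move=> t t0 tt; rewrite big_cons hornerM hornerXsubC cabsM.
  have /andP[cle leC] := cC t t0 tt.
  have zr : cabs ((expR (- t))%:C * zeta - r) <= 1 + cabs r.
    have := cabsD ((expR (- t))%:C * zeta) (- r); rewrite cabs_polar // cabsN.
    have : expR (- t) < 1 by rewrite expR_lt1 oppr_lt0.
    lra.
  apply/andP; split; apply: ler_pM; rewrite ?cabs_ge0 //; first exact: ltW.
    exact: ltW.
  exact: c'P.
have [c [C [c0 cC]]] := main rs (fun _ => id).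
exists (cabs (lead_coef G) * c), (cabs (lead_coef G) * C); split.
  by rewrite mulr_gt0 // cabs_gt0.
move=> t t0 tt.
have -> z : cabs G.[z] = cabs (lead_coef G) * cabs (\prod_(r <- rs) ('X - r%:P)).[z].
  by rewrite {1}GE hornerZ cabsM.
by have /andP[] := cC t t0 tt => *; rewrite !ler_wpM2l ?cabs_ge0.
Qed.

(** The factor [('X - zeta) ^+ a] has modulus [(1 - exp (- t)) ^+ a], and
    [1 - exp (- t)] lies between [t / 2] and [t]. *)
Lemma horner_growth (P h : {poly R[i]}) a tau zeta :
  cabs zeta = 1 -> P = ('X - zeta%:P) ^+ a * h -> ~~ root h zeta -> tau <= 1 ->
  (forall r, root P r -> cabs r < 1 -> cabs r < expR (- tau)) ->
  exists C, forall t, 0 < t -> t <= tau ->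
    P.[(expR (- t))%:C * zeta] != 0 /\
    `|ln (cabs P.[(expR (- t))%:C * zeta]) - a%:R * ln t| <= C.
Proof.
move=> zeta1 PE hz tau1 gap.
have [|c [C [c0 cC]]] := @horner_away_from_roots h tau zeta zeta1 hz.
  by move=> r hr; apply: gap; rewrite PE rootM hr orbT.
exists (a%:R * ln 2 + (`|ln c| + `|ln C|)) => t t0 tt.
have t1 : t <= 1 by exact: le_trans tau1.
set z := _ * zeta; have /andP[cz zC] := cC t t0 tt; rewrite -/z in cz zC.
have /andP[e1 e2] := one_minus_expRN t0 t1.
have zz : cabs (z - zeta) = 1 - expR (- t).
  have -> : z - zeta = (expR (- t) - 1)%:C * zeta.
    by rewrite /z rmorphB rmorph1 mulrBl mul1r.
  rewrite cabsM zeta1 mulr1 cabs_real ler0_norm ?opprB //; lra.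
have Pz : cabs P.[z] = (1 - expR (- t)) ^+ a * cabs h.[z].
  by rewrite PE hornerM horner_exp hornerXsubC cabsM cabsX zz.
have e0 : 0 < 1 - expR (- t) by apply: lt_le_trans e1; rewrite divr_gt0.
have h0 : 0 < cabs h.[z] by exact: lt_le_trans cz.
split; first by rewrite -cabs_gt0 Pz mulr_gt0 // exprn_gt0.
rewrite Pz lnM ?posrE ?exprn_gt0 // lnXn // -[ln _ *+ a]mulr_natl addrAC -mulrBr.
apply: le_trans (ler_normD _ _) _; apply: lerD; last exact: ln_bounds.
rewrite normrM normr_nat ler_wpM2l //.
have l1 : ln (1 - expR (- t)) <= ln t by rewrite ler_ln.
have l2 : ln t - ln 2 <= ln (1 - expR (- t)).
  by rewrite -ln_div ?posrE // ler_ln ?posrE ?divr_gt0.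
rewrite ler_norml; apply/andP; split; lra.
Qed.

End LocalGrowth.

(** * The generating function of the set *)

Section GeneratingFunction.
Import Order.TTheory GRing.Theory Num.Theory.
Import numFieldNormedType.Exports.
Local Open Scope classical_set_scope.
Local Open Scope ring_scope.
Local Open Scope complex_scope.

(** As all [k i] are positive, the entries of a representation of [n] are at most
    [n]. *)
Lemma repr_count_box d (A : set nat) (k : 'I_d -> nat) n B :
  (forall i, 0 < k i)%N -> (n < B)%N ->
  repr_count A k n =
  #|[pred x : {ffun 'I_d -> 'I_B} |
      `[< forall i, A (x i) >] && (\sum_i k i * x i == n)%N]|.
Proof.
move=> k_gt0 ltnB; rewrite /repr_count.
set p := [pred x : {ffun 'I_d -> 'I_B} | _].
pose h (x : {ffun 'I_d -> 'I_B}) : {ffun 'I_d -> nat} := [ffun i => nat_of_ord (x i)].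
have h_inj : injective h.
  move=> x y xy; apply/ffunP => i; apply/val_inj.
  by have := congr1 (fun u : {ffun 'I_d -> nat} => u i) xy; rewrite !ffunE.
suff -> : fset_set (representations A k n) = [fset h x | x in p]%fset.
  by rewrite card_imfset // cardE.
apply/fsetP => y; rewrite in_fset_set; last exact: finite_representations.
apply/idP/imfsetP => [|[x /= /andP[/asboolP Ax /eqP sx] ->]]; rewrite inE.
  move=> [Ay sy].
  have yB i : (y i < B)%N.
    apply: leq_ltn_trans ltnB; rewrite -sy (bigD1 i) //=.
    by apply: leq_trans (leq_addr _ _); rewrite leq_pmull.
  exists [ffun i => Ordinal (yB i)].
    apply/andP; split; first by apply/asboolP => i; rewrite ffunE; exact: Ay.
    by rewrite -sy; apply/eqP/eq_bigr => i _; rewrite ffunE.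
  by apply/ffunP => i; rewrite !ffunE.
split=> [i|]; first by rewrite ffunE.
by rewrite -sx; apply: eq_bigr => i _; rewrite ffunE.
Qed.

Variable R : realType.
Implicit Types (z : R[i]) (A : set nat).

Definition psum (A : set nat) (B : nat) (z : R[i]) : R[i] :=
  \sum_(a < B) (`[< A a >])%:R * z ^+ a.

(** The modulus of the power series with exponents in [A], obtained as a limit of
    real numbers: only moduli enter the proof, and they are multiplicative. *)
Definition absF (A : set nat) (z : R[i]) : R := limn (fun B => cabs (psum A B z)).

Lemma geometric_sum_le (x : R) B : 0 <= x -> x < 1 -> \sum_(a < B) x ^+ a <= (1 - x)^-1.
Proof.
move=> x0 x1; rewrite -div1r ler_pdivlMr ?subr_gt0 //.
have := subrX1 x B; set S := \sum_(a < B) _ => E.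
have -> : S * (1 - x) = 1 - x ^+ B by rewrite mulrC -[LHS]opprK -mulNr opprB -E opprB.
by rewrite gerBl exprn_ge0.
Qed.

Lemma cabs_psum_le A B z : cabs z < 1 -> cabs (psum A B z) <= (1 - cabs z)^-1.
Proof.
move=> z1; apply: le_trans (geometric_sum_le B (cabs_ge0 z) z1).
apply: le_trans (cabs_sum _ _ _) _; apply: ler_sum => a _.
rewrite cabsM cabsX ler_piMl ?exprn_ge0 ?cabs_ge0 //.
by case: asboolP => _; rewrite ?cabs1 ?cabs0.
Qed.

Lemma cabs_psum_cvg A z : cabs z < 1 -> cvgn (fun B => cabs (psum A B z)).
Proof.
move=> z1; pose G B := \sum_(a < B) cabs z ^+ a.
have term B : cabs ((`[< A B >])%:R * z ^+ B) <= cabs z ^+ B.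
  rewrite cabsM cabsX ler_piMl ?exprn_ge0 ?cabs_ge0 //.
  by case: asboolP => _; rewrite ?cabs1 ?cabs0.
have cvgG : cvgn G.
  apply: nondecreasing_is_cvgn.
    by apply/nondecreasing_seqP => B; rewrite /G big_ord_recr lerDl exprn_ge0 ?cabs_ge0.
  by exists (1 - cabs z)^-1 => _ [B _ <-]; rewrite geometric_sum_le ?cabs_ge0.
have cvgS : cvgn (fun B => cabs (psum A B z) + G B).
  (* Adding the geometric sums makes the sequence monotone. *)
  apply: nondecreasing_is_cvgn.
    apply/nondecreasing_seqP => B; rewrite /G big_ord_recr /= [_ + cabs z ^+ B]addrC addrA lerD2r.
    have := cabsD (psum A B.+1 z) (- ((`[< A B >])%:R * z ^+ B)); rewrite cabsN.
    rewrite {1}/psum big_ord_recr /= addrK -/(psum A B z) => /le_trans; apply.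
    by rewrite lerD2l.
  exists ((1 - cabs z)^-1 + (1 - cabs z)^-1) => _ [B _ <-].
  by rewrite lerD ?cabs_psum_le ?geometric_sum_le ?cabs_ge0.
have -> : (fun B => cabs (psum A B z)) = (fun B => cabs (psum A B z) + G B - G B).
  by apply/funext => B; rewrite addrK.
exact: is_cvgB.
Qed.

Lemma absF_ge0 A z : cabs z < 1 -> 0 <= absF A z.
Proof.
move=> z1; rewrite /absF; apply: limr_ge; first exact: cabs_psum_cvg.
by apply: nearW => B; exact: cabs_ge0.
Qed.

Lemma absF_le A z : cabs z < 1 -> absF A z <= (1 - cabs z)^-1.
Proof.
move=> z1; rewrite /absF; apply: limr_le; first exact: cabs_psum_cvg.
by apply: nearW => B; exact: cabs_psum_le.
Qed.

Lemma prod_psum d A (k : 'I_d -> nat) B z :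
  \prod_i psum A B (z ^+ k i) =
  \sum_(x : {ffun 'I_d -> 'I_B}) (`[< forall i, A (x i) >])%:R * z ^+ (\sum_i k i * x i)%N.
Proof.
rewrite bigA_distr_bigA; apply: eq_bigr => x _; rewrite big_split /=.
congr (_ * _); last first.
  by rewrite expr_sum; apply: eq_bigr => i _; rewrite exprM.
case: asboolP => [Ax|nAx].
  by rewrite big1 // => i _; case: asboolP => // /(_ (Ax i)).
have [i nAi] : exists i, ~ A (x i) by exact/existsNP.
by rewrite (bigD1 i) //=; case: asboolP => // _; rewrite mul0r.
Qed.

(** [(1 - z)] times the generating function of the representation counts, when
    these are equal to [c] from [N] on. *)
Definition numer d A (k : 'I_d -> nat) (c N : nat) : {poly int} :=
  (1 - 'X) * (\sum_(n < N) (repr_count A k n)%:R *: 'X^n) + c%:R *: 'X^N.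

Lemma horner_numer d A (k : 'I_d -> nat) c N B z :
  (forall n, N <= n -> repr_count A k n = c)%N -> (N <= B)%N ->
  (map_poly intr (numer A k c N)).[z] =
  (1 - z) * \sum_(n < B) (repr_count A k n)%:R * z ^+ n + c%:R * z ^+ B.
Proof.
move=> rc leNB; rewrite -(subnKC leNB); elim: (B - N)%N => [|j IH].
  rewrite addn0 /numer rmorphD rmorphM rmorphB rmorph1 /= map_polyX map_polyZ /=.
  rewrite map_polyXn rmorph_sum /= !hornerE horner_sum rmorph_nat.
  congr (_ * _ + _); apply: eq_bigr => n _.
  by rewrite map_polyZ /= map_polyXn rmorph_nat !hornerE.
by rewrite IH addnS big_ord_recr /= rc ?leq_addr // exprS; ring.
Qed.

(** A partial product contains the right coefficients below degree [B]; beyond,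
    one half of the exponent is spent on the bound [sg ^+ B], with [sg] the square
    root of [cabs z], and the other half on a convergent product. *)
Lemma psum_tail d A (k : 'I_d -> nat) B z :
  (forall i, 0 < k i)%N -> cabs z < 1 ->
  cabs (\prod_i psum A B (z ^+ k i) - \sum_(n < B) (repr_count A k n)%:R * z ^+ n)
  <= Num.sqrt (cabs z) ^+ B * (1 - Num.sqrt (cabs z))^-1 ^+ d.
Proof.
move=> k_gt0 z1; set sg := Num.sqrt (cabs z).
have sg0 : 0 <= sg by exact: sqrtr_ge0.
have sgE : sg ^+ 2 = cabs z by rewrite sqr_sqrtr ?cabs_ge0.
have sg1 : sg < 1 by rewrite -(@ltr_pXn2r _ 2) ?nnegrE // sgE expr1n.
pose w (x : {ffun 'I_d -> 'I_B}) := (\sum_i k i * x i)%N.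
rewrite prod_psum (bigID (fun x => w x < B)%N) /=.
have -> : \sum_(x : {ffun 'I_d -> 'I_B} | (w x < B)%N)
    (`[< forall i, A (x i) >])%:R * z ^+ w x =
    \sum_(n < B) (repr_count A k n)%:R * z ^+ n.
  transitivity (\sum_(n < B) \sum_(x : {ffun 'I_d -> 'I_B} | w x == n)
      (`[< forall i, A (x i) >])%:R * z ^+ w x).
    rewrite (exchange_big_dep (fun x => w x < B)%N) /=; last by move=> n x _ /eqP ->.
    by apply: eq_bigr => x wx; rewrite (big_pred1 (Ordinal wx)).
  apply: eq_bigr => n _; rewrite (repr_count_box A k_gt0 (ltn_ord n)).
  rewrite -sum1_card natr_sum mulr_suml [RHS]big_mkcond [LHS]big_mkcond /=.
  apply: eq_bigr => x _; rewrite inE /= -/(w x).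
  by case: eqP => [->|_]; case: asboolP; rewrite ?mul0r.
rewrite addrAC subrr add0r; apply: le_trans (cabs_sum _ _ _) _.
apply: (@le_trans _ _ (\sum_(x : {ffun 'I_d -> 'I_B}) sg ^+ B * sg ^+ w x)).
  rewrite [leRHS](bigID (fun x => w x < B)%N) /= ler_wpDl //.
    by apply: sumr_ge0 => x _; rewrite mulr_ge0 ?exprn_ge0.
  apply: ler_sum => x; rewrite -leqNgt => wx.
  rewrite cabsM cabsX -sgE -exprM mulnC exprM expr2.
  apply: (@le_trans _ _ (1 * (sg ^+ w x * sg ^+ w x))).
    rewrite ler_pM ?cabs_ge0 ?mulr_ge0 ?exprn_ge0 //.
    by case: asboolP => _; rewrite ?cabs1 ?cabs0.
  by rewrite mul1r ler_wpM2r ?exprn_ge0 // ler_wiXn2l // ltW.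
rewrite -mulr_sumr ler_wpM2l ?exprn_ge0 //.
apply: (@le_trans _ _ (\sum_(x : {ffun 'I_d -> 'I_B}) \prod_i sg ^+ x i)).
  apply: ler_sum => x _; rewrite /w expr_sum; apply: ler_prod => i _.
  by rewrite exprn_ge0 //= ler_wiXn2l ?(ltW sg1) // leq_pmull.
have -> : \sum_(x : {ffun 'I_d -> 'I_B}) \prod_i sg ^+ x i =
    \prod_(i < d) \sum_(a < B) sg ^+ a by rewrite bigA_distr_bigA.
rewrite -[X in _ ^+ X](card_ord d) -prodr_const.
apply: ler_prod => i _; rewrite geometric_sum_le // andbT.
by apply: sumr_ge0 => a _; rewrite exprn_ge0.
Qed.

(** The identity [(1 - z) * \prod_i F (z ^ k i) = P z] for moduli, obtained in the
    limit from the partial products. *)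
Lemma absF_prod d A (k : 'I_d -> nat) c N z :
  (forall i, 0 < k i)%N -> (forall n, N <= n -> repr_count A k n = c)%N ->
  cabs z < 1 ->
  (\prod_i absF A (z ^+ k i)) * cabs (1 - z) =
  cabs (map_poly intr (numer A k c N)).[z].
Proof.
move=> k_gt0 rc z1; set sg := Num.sqrt (cabs z).
have sg0 : 0 <= sg by exact: sqrtr_ge0.
have sgE : sg ^+ 2 = cabs z by rewrite sqr_sqrtr ?cabs_ge0.
have sg1 : sg < 1 by rewrite -(@ltr_pXn2r _ 2) ?nnegrE // sgE expr1n.
pose u B := (\prod_i cabs (psum A B (z ^+ k i))) * cabs (1 - z).
have lim1 : u @ \oo --> (\prod_i absF A (z ^+ k i)) * cabs (1 - z).
  apply: cvgMl; apply: (@cvg_big _ _ _ _ _ mul_continuous) => // i _.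
  apply: cabs_psum_cvg; rewrite cabsX exprn_ilt1 ?cabs_ge0 //.
  by rewrite -lt0n.
suff lim2 : u @ \oo --> cabs (map_poly intr (numer A k c N)).[z].
  exact: (cvg_unique _ lim1 lim2).
apply/cvgrPdist_le => eps eps0.
pose K : R := 2 * (1 - sg)^-1 ^+ d + c%:R.
have limK : (fun B => K * sg ^+ B) @ \oo --> (0 : R).
  rewrite -(mulr0 K); apply: cvgMr; apply: cvg_expr.
  by rewrite ger0_norm.
move/cvgr0Pnorm_le : limK => /(_ eps eps0).
apply: filterS2 (nbhs_infty_ge N) => B leNB; rewrite -/(_ <= _)%N in leNB.
apply: le_trans; rewrite [leRHS]ger0_norm; last first.
  by rewrite mulr_ge0 ?exprn_ge0 // addr_ge0 // mulr_ge0 // exprn_ge0 // invr_ge0 subr_ge0 ltW.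
rewrite /u -cabs_prod -cabsM; apply: le_trans (cabs_dist _ _) _.
rewrite (horner_numer z rc leNB) cabsB.
set S := \sum_(n < B) _; set Q := \prod_i _.
have -> : Q * (1 - z) - ((1 - z) * S + c%:R * z ^+ B) =
   (1 - z) * (Q - S) + - (c%:R * z ^+ B) by ring.
apply: le_trans (cabsD _ _) _; rewrite cabsN !cabsM /K mulrDl.
apply: lerD.
  rewrite -mulrA; apply: ler_pM; rewrite ?cabs_ge0 //; last first.
    by rewrite mulrC; exact: psum_tail.
  by have := cabsD 1 (- z); rewrite cabs1 cabsN; lra.
rewrite cabsX -sgE -exprM mulnC exprM expr2.
have -> : cabs c%:R = c%:R :> R.
  by rewrite -(rmorph_nat (real_complex R)) cabs_real normr_nat.
by rewrite ler_wpM2l // ler_piMl ?exprn_ge0 // exprn_ile1 // ltW.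
Qed.

End GeneratingFunction.

(** * The theorem *)

Section Combinatorics.
Local Open Scope nat_scope.

(** Taking all entries equal to a large element of [A] gives a representation of a
    large number. *)
Lemma eventual_value_gt0 d (A : set nat) (k : 'I_d -> nat) c N :
  0 < d -> (forall i, 0 < k i) -> infinite_set A ->
  (forall n, N <= n -> repr_count A k n = c) -> 0 < c.
Proof.
move=> d_gt0 k_gt0 Ainf rc.
have [a Aa leNa] : exists2 a, A a & N <= a.
  apply: contrapT => none; apply: Ainf.
  apply: (@sub_finite_set _ _ `I_N); last exact: finite_II.
  by move=> a Aa /=; rewrite ltnNge; apply/negP => leNa; apply: none; exists a.
pose n := \sum_(i < d) k i * a.
have le_an : a <= n.
  rewrite /n (bigD1 (Ordinal d_gt0)) //=.
  by apply: leq_trans (leq_addr _ _); rewrite leq_pmull.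
rewrite -(rc n (leq_trans leNa le_an)) (repr_count_box A k_gt0 (ltnSn n)).
apply/card_gt0P; exists [ffun=> inord a].
rewrite inE; apply/andP; split.
  by apply/asboolP => i; rewrite ffunE inordK.
by apply/eqP; apply: eq_bigr => i _; rewrite ffunE inordK.
Qed.

(** Numbers congruent to 1 modulo [p] are not represented. *)
Lemma eventual_value_eq0 d (A : set nat) (k : 'I_d -> nat) c N p :
  1 < p -> (forall i, 0 < k i) -> (forall i, p %| k i) ->
  (forall n, N <= n -> repr_count A k n = c) -> c = 0.
Proof.
move=> p_gt1 k_gt0 pk rc.
have le_N : N <= (N * p).+1 by rewrite ltnW // ltnS leq_pmulr // ltnW.
rewrite -(rc _ le_N) (repr_count_box A k_gt0 (ltnSn _)).
apply: eq_card0 => x; rewrite !inE; apply/negP => /andP[_ /eqP sumE].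
have : p %| (N * p).+1.
  by rewrite -sumE; apply: dvdn_sum => i _; exact: dvdn_mulr.
by rewrite -addn1 dvdn_addr ?dvdn_mull // dvdn1 => /eqP p1; rewrite p1 in p_gt1.
Qed.

End Combinatorics.

Section Main.
Import Order.TTheory GRing.Theory Num.Theory.
Import numFieldNormedType.Exports.
Local Open Scope classical_set_scope.
Local Open Scope ring_scope.
Local Open Scope complex_scope.

Variable R : realType.

Lemma ln_prod I (r : seq I) (f : I -> R) :
  (forall i, 0 < f i) -> ln (\prod_(i <- r) f i) = \sum_(i <- r) ln (f i).
Proof.
move=> f0; elim: r => [|i r IH]; first by rewrite !big_nil ln1.
by rewrite !big_cons lnM ?posrE ?prodr_gt0 // IH.
Qed.

Lemma sum_ord_le n (P : pred 'I_n) (f : 'I_n -> R) c :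
  0 <= c -> (forall i, f i <= c) -> \sum_(i < n | P i) f i <= n%:R * c.
Proof.
move=> c0 fc; apply: (@le_trans _ _ (\sum_(i < n | P i) c)); first exact: ler_sum.
rewrite sumr_const -[X in X <= _]mulr_natl ler_wpM2r // ler_nat.
by rewrite -[X in (_ <= X)%N](card_ord n) max_card.
Qed.

(** The form in which the relation between logarithms is used to bound one of them
    from below: the others, with sum [v], are bounded from above. *)
Lemma two_sided_bound (x Y D p u v r C1 C2 : R) :
  0 <= x -> 0 <= Y -> 0 <= D -> 0 <= p ->
  u <= x + `|C1| -> v <= D * (x + (Y + p)) -> - C2 <= u + v + r * (x + Y) ->
  `|u| <= (1 + `|C1| + `|C2| + `|r| * (1 + Y) + D * (1 + (Y + p))) * (1 + x).
Proof.
move=> x0 Y0 D0 p0 ux vx low.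
have rY : r * (x + Y) <= `|r| * (x + Y) by rewrite ler_wpM2r ?addr_ge0 ?ler_norm.
have C2n := ler_norm C2.
move: (normr_ge0 C1) (normr_ge0 C2) (normr_ge0 r) ux rY C2n.
move: `|C1| `|C2| `|r| => c1 c2 r' c1_0 c2_0 r0 ux rY C2n.
have p1 : 0 <= r' * Y by rewrite mulr_ge0.
have p2 : 0 <= D * (Y + p) by rewrite mulr_ge0 ?addr_ge0.
have p3 : 0 <= r' * Y * x by rewrite mulr_ge0.
have p4 : 0 <= D * (Y + p) * x by rewrite mulr_ge0.
have p5 : 0 <= c1 * x by rewrite mulr_ge0.
have p6 : 0 <= c2 * x by rewrite mulr_ge0.
have p7 : 0 <= D * x by rewrite mulr_ge0.
have p8 : 0 <= r' * x by rewrite mulr_ge0.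
rewrite ler_norml; apply/andP; split; lra.
Qed.

(** The coefficients of the series are at most 1, so its modulus is at most
    [1 / (1 - exp (- t)) <= 2 / t]. *)
Lemma ln_absF_le A (w : R[i]) t : 0 < t -> t <= 1 -> cabs w <= expR (- t) ->
  ln (absF A w) <= ln 2 - ln t.
Proof.
move=> t0 t1 wt; have /andP[e1 e2] := one_minus_expRN t0 t1.
have w1 : cabs w < 1 by apply: le_lt_trans wt _; rewrite expR_lt1 oppr_lt0.
have F0 : 0 <= ln 2 - ln t :> R.
  by rewrite subr_ge0 ler_ln ?posrE //; lra.
have := absF_ge0 A w1; rewrite le_eqVlt => /orP[/eqP <-|F_gt0]; first by rewrite ln0.
rewrite -ln_div ?posrE // ler_ln ?posrE ?divr_gt0 //.
apply: le_trans (absF_le A w1) _.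
rewrite -[2 / t]invrK lef_pV2 ?posrE ?invr_gt0 ?divr_gt0 ?subr_gt0 // invf_div.
lra.
Qed.

Lemma numer_at1 d A (k : 'I_d -> nat) c N : (numer A k c N).[1] = c%:R.
Proof. by rewrite /numer !hornerE expr1n mulr1. Qed.

(** The order of [p / (1 - z)] at the primitive [n]-th roots of unity, with an error
    term independent of the root; the denominator contributes for [n = 1]
    only. *)
Lemma log_growth_at_prim_roots (p : {poly int}) n tau :
  (0 < n)%N -> p != 0 -> 0 < tau -> tau <= 1 ->
  (forall r : R[i], root (map_poly intr p) r -> cabs r < 1 -> cabs r < expR (- tau)) ->
  exists a, (forall z : R[i], n.-primitive_root z ->
      exists2 h, map_poly intr p = ('X - z%:P) ^+ a * h & ~~ root h z) /\
    exists C, forall (z : R[i]) t, n.-primitive_root z -> 0 < t -> t <= tau ->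
      let w := (expR (- t))%:C * z in
      [/\ (map_poly intr p).[w] != 0, 1 - w != 0 &
        `|ln (cabs (map_poly intr p).[w]) - ln (cabs (1 - w)) -
          (a%:R - (n == 1%N)%:R) * ln t| <= C].
Proof.
move=> n_gt0 p0 tau0 tau1 gap.
have [a aP] := prim_root_multiplicity (R[i] : numClosedFieldType) n_gt0 p0.
exists a; split=> //.
have [om prim_om] := prim_root_exists (R[i] : numClosedFieldType) n_gt0.
have loc (z : R[i]) : exists C, n.-primitive_root z -> forall t, 0 < t -> t <= tau ->
    let w := (expR (- t))%:C * z in
    [/\ (map_poly intr p).[w] != 0, 1 - w != 0 &
      `|ln (cabs (map_poly intr p).[w]) - ln (cabs (1 - w)) -
        (a%:R - (n == 1%N)%:R) * ln t| <= C].
  have [prim_z|nprim] := boolP (n.-primitive_root z); last by exists 0.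
  have z1 : cabs z = 1 by apply: (cabs_root_unity n_gt0); exact: prim_expr_order.
  have [h hE hz] := aP z prim_z.
  have [C1 C1P] := horner_growth z1 hE hz tau1 gap.
  have [h' h'E h'z] : exists2 h', 1 - 'X = ('X - z%:P) ^+ (n == 1%N) * h' & ~~ root h' z.
    have [n1|n1] := eqVneq n 1%N.
      exists (-1); last by rewrite rootN root1.
      have -> : z = 1 by have := prim_expr_order prim_z; rewrite n1 expr1.
      by rewrite expr1 mulrN1 opprB.
    exists (1 - 'X); first by rewrite mul1r.
    rewrite rootE !hornerE subr_eq0; apply: contraNneq n1 => z1'.
    by rewrite -dvdn1 (prim_order_dvd prim_z) expr1 z1'.
  have [|C2 C2P] := horner_growth z1 h'E h'z tau1.
    move=> r; rewrite rootE !hornerE subr_eq0 => /eqP <-.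
    by rewrite cabs1 ltxx.
  exists (C1 + C2) => _ t t0 tt w.
  have [nz1 le1] := C1P t t0 tt; have [nz2 le2] := C2P t t0 tt.
  rewrite -/w !hornerE in nz1 le1 nz2 le2; split=> //.
  set x := ln (cabs _) in le1 *; set y := ln (cabs _) in le2 *.
  have -> : x - y - (a%:R - (n == 1%N)%:R) * ln t =
    (x - a%:R * ln t) - (y - (n == 1%N)%:R * ln t) by ring.
  exact: le_trans (ler_normB _ _) (lerD le1 le2).
have /choice[C CP] := fun j : 'I_n => loc (om ^+ j).
(* The n-th roots of unity are finite in number, so their constants can be added. *)
exists (\sum_j `|C j|) => z t prim_z t0 tt w.
have [j zE] := prim_rootP prim_om (prim_expr_order prim_z).
have := CP j; rewrite -zE => /(_ prim_z t t0 tt)[nz1 nz2 le]; split=> //.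
apply: le_trans le _; rewrite (bigD1 j) //= (le_trans (ler_norm _)) // lerDl.
exact: sumr_ge0.
Qed.

(** The statement for a field [R] of real numbers that is still arbitrary.  The numbers
    [g e s] are the logarithms of [absF A] at the points [w e (s + 1)]; the offset 1
    keeps all scale vectors nonnegative when the relation at [s + 2] is written
    in terms of [s + 1 + (1 - b i)]. *)
Lemma not_eventually_constant (m d : nat) (hd : (0 < d)%N)
    (q : 'I_m -> nat) (hq : forall j, (1 < q j)%N)
    (hcop : forall j1 j2, j1 != j2 -> coprime (q j1) (q j2))
    (b : 'I_d -> 'I_m -> bool) (hb : forall i, exists j, b i j)
    (k : 'I_d -> nat) (hk : forall i, k i = (\prod_(j < m) q j ^ b i j)%N)
    (A : set nat) (hA : infinite_set A) c N :
  ~ (forall n : nat, (N <= n)%N -> repr_count A k n = c).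
Proof.
move=> rc.
have q_gt0 l : (0 < q l)%N by exact: ltnW.
have k_gt0 i : (0 < k i)%N by rewrite hk prodn_gt0 // => l; rewrite expn_gt0 q_gt0.
have c_gt0 : (0 < c)%N := eventual_value_gt0 hd k_gt0 hA rc.
have hb' l : exists i, ~~ b i l.
  apply: contrapT => none; suff c0 : c = 0%N by rewrite c0 in c_gt0.
  apply: (eventual_value_eq0 (hq l) k_gt0 _ rc) => i.
  rewrite hk (bigD1 l) //= dvdn_mulr //; case bil : (b i l); first exact: dvdnn.
  by case: none; exists i; rewrite bil.
pose P := numer A k c N.
have P1 : P.[1] != 0 by rewrite numer_at1 pnatr_eq0 -lt0n.
have P_neq0 : P != 0 by apply: contraNneq P1 => ->; rewrite horner0.
pose PC : {poly R[i]} := map_poly intr P.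
have PC1 : PC.[1] != 0.
  by rewrite -(rmorph1 (intmul 1 : int -> R[i])) horner_map /= intr_eq0.
have PC_neq0 : PC != 0 by apply: contraNneq PC1 => ->; rewrite horner0.
have [rs PCE] := closed_field_poly_normal PC.
have rsP r : root PC r = (r \in rs).
  by rewrite {1}PCE rootZ ?lead_coef_eq0 // root_prod_XsubC.
have [tau [tau0 tau1 gap0]] := root_gap rs.
(* From here on all radii are at least exp (- tau), beyond the roots of P in the disc. *)
have gap r : root PC r -> cabs r < 1 -> cabs r < expR (- tau) by rewrite rsP; exact: gap0.
pose ord (e : 'I_m -> nat) := (\prod_l q l ^ e l)%N.
have ord_gt0 e : (0 < ord e)%N by rewrite prodn_gt0 // => l; rewrite expn_gt0 q_gt0.
have /choice[a aP] := fun e => log_growth_at_prim_roots (ord_gt0 e) P_neq0 tau0 tau1 gap.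
pose rho e : int := (a e)%:Z - (ord e == 1%N)%:Z.
have rhoE e : (rho e)%:~R = (a e)%:R - (ord e == 1%N)%:R :> R by rewrite rmorphB /=.
have [th [th_prim th_rel]] := phase_system (R[i] : numClosedFieldType) q_gt0 hcop.
pose t (s : 'I_m -> nat) : R := tau / (ord s)%:R.
have t_gt0 s : 0 < t s by rewrite divr_gt0 // ltr0n.
have t_le s : t s <= tau by rewrite ler_pdivrMr ?ltr0n // ler_peMr ?(ltW tau0) // ler1n.
have t_le1 s : t s <= 1 by exact: le_trans tau1.
pose al l : R := ln (q l)%:R.
have al_gt0 l : 0 < al l by rewrite ln_gt0 // ltr1n.
pose S (s : 'I_m -> nat) := \sum_l (s l)%:R * al l.
have S_ge0 s : 0 <= S s by apply: sumr_ge0 => l _; rewrite mulr_ge0 // ltW.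
have ln_t s : ln (t s) = ln tau - S s.
  rewrite ln_div ?posrE ?ltr0n //; congr (_ - _).
  rewrite /ord natr_prod ln_prod => [|l]; last by rewrite ltr0n expn_gt0 q_gt0.
  by apply: eq_bigr => l _; rewrite natrX lnXn ?ltr0n // mulr_natl.
have SD s (u : 'I_m -> bool) : S (raise s u) = S s + S (fun l => u l : nat).
  by rewrite -big_split; apply: eq_bigr => l _; rewrite /raise natrD mulrDl.
pose w e s : R[i] := (expR (- t s))%:C * th e s.
have th1 e s : cabs (th e s) = 1.
  by apply: (cabs_root_unity (ord_gt0 e)); exact: (prim_expr_order (th_prim e s)).
have w_abs e s : cabs (w e s) = expR (- t s) by exact: cabs_polar.
have w_lt1 e s : cabs (w e s) < 1 by rewrite w_abs expR_lt1 oppr_lt0.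
have w_rel e s i : w e (raise s (b i)) ^+ k i = w (lower e (b i)) s.
  rewrite /w exprMn hk th_rel -rmorphXn; congr (_%:C * _).
  rewrite -expRM_natl; congr expR; rewrite mulrN; congr (- _).
  rewrite /t /ord /raise.
  have -> : (\prod_l q l ^ (s l + b i l) = \prod_l q l ^ s l * \prod_l q l ^ b i l)%N.
    by rewrite -big_split; apply: eq_bigr => l _; rewrite expnD.
  rewrite natrM; set x : R := (\prod_l q l ^ s l)%N%:R; set y : R := _%:R.
  have x0 : x != 0 by rewrite pnatr_eq0 -lt0n ord_gt0.
  have y0 : y != 0 by rewrite pnatr_eq0 -lt0n (ord_gt0 (fun l => b i l)).
  by field; rewrite x0 y0.
have wk_abs e s i : cabs (w e s ^+ k i) <= expR (- t s).
  rewrite cabsX w_abs -[leRHS]expr1 ler_wiXn2l ?expR_ge0 //.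
  by rewrite -(w_abs e) ltW.
(* P has no zero at the points w e s, so no factor of the product vanishes there. *)
have F_gt0 e s i : 0 < absF A (w e s ^+ k i).
  have [_ [C CP]] := aP e; have [nz1 nz2 _] := CP _ _ (th_prim e s) (t_gt0 s) (t_le s).
  have wk1 : cabs (w e s ^+ k i) < 1.
    by apply: le_lt_trans (wk_abs _ _ _) _; rewrite expR_lt1 oppr_lt0.
  rewrite lt_def absF_ge0 // andbT; apply: contraNneq nz1 => F0.
  rewrite -cabs_eq0 -(absF_prod k_gt0 rc (w_lt1 e s)) (bigD1 i) //= F0 mul0r mul0r //.
have eqn e : exists C, forall s,
    `|\sum_i ln (absF A (w e s ^+ k i)) + (rho e)%:~R * S s| <= C.
  have [_ [C CP]] := aP e; exists (C + `|(rho e)%:~R * ln tau|) => s.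
  have [nz1 nz2 le] := CP _ _ (th_prim e s) (t_gt0 s) (t_le s).
  rewrite -/(w e s) -/PC -rhoE in nz1 nz2 le.
  have -> : \sum_i ln (absF A (w e s ^+ k i)) + (rho e)%:~R * S s =
    (ln (cabs PC.[w e s]) - ln (cabs (1 - w e s)) - (rho e)%:~R * ln (t s))
    + (rho e)%:~R * ln tau.
    rewrite -(absF_prod k_gt0 rc (w_lt1 e s)) lnM ?posrE ?prodr_gt0 ?cabs_gt0 //.
    by rewrite ln_prod // ln_t; ring.
  by apply: le_trans (ler_normD _ _) _; rewrite lerD2r.
clearbody w.
pose one (l : 'I_m) := true.
pose g e s := ln (absF A (w e (raise s one))).
have g_le e : exists C, forall s, g e s <= S s + C.
  exists (ln 2 - ln tau + S (fun l => one l : nat)) => s.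
  apply: le_trans (ln_absF_le A (t_gt0 (raise s one)) (t_le1 _) _) _.
    by rewrite w_abs.
  by rewrite ln_t SD; lra.
have raise2 s i : raise (raise (raise s (fun l => ~~ b i l)) one) (b i) =
    raise (raise s one) one.
  by apply/funext => l; rewrite /raise /one; case: (b i l) => /=; lia.
have g_eq e : exists C, forall s,
    `|\sum_(i < d) g (lower e (b i)) (raise s (fun l => ~~ b i l)) + (rho e)%:~R * S s| <= C.
  have [C CP] := eqn e.
  exists (C + `|(rho e)%:~R * (S (fun l => one l : nat) + S (fun l => one l : nat))|) => s.
  have sumE : \sum_i g (lower e (b i)) (raise s (fun l => ~~ b i l)) =
     \sum_i ln (absF A (w e (raise (raise s one) one) ^+ k i)).
    apply: eq_bigr => i _.
    by rewrite /g -(w_rel e (raise (raise s (fun l => ~~ b i l)) one) i) raise2.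
  rewrite {}sumE; have := CP (raise (raise s one) one).
  rewrite !SD; set X := \sum_i _; set Y := S (fun l => one l : nat) => le.
  have -> : X + (rho e)%:~R * S s =
     (X + (rho e)%:~R * (S s + Y + Y)) - (rho e)%:~R * (Y + Y) by ring.
  by apply: le_trans (ler_normB _ _) _; rewrite lerD2r.
have i0 : 'I_d := Ordinal hd.
have lower_raise e i : lower (raise e (b i)) (b i) = e.
  by apply/funext => l; rewrite /lower /raise addnK.
(* The upper bound is ln_absF_le.  For the lower bound, g e s occurs as the i0-th term
   of the relation at e', whose other terms are bounded from above. *)
have g_bnd e : exists C, forall s, `|g e s| <= C * (1 + S s).
  have [C1 C1P] := g_le e.
  pose e' := raise e (b i0); have [C2 C2P] := eqn e'.
  pose Y := S (fun l => one l : nat) + S (fun l => b i0 l : nat).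
  have Y0 : 0 <= Y by rewrite addr_ge0.
  pose p := `|ln 2 - ln tau|.
  exists (1 + `|C1| + `|C2| + `|(rho e')%:~R| * (1 + Y) + d%:R * (1 + (Y + p))) => s.
  pose s' := raise (raise s one) (b i0).
  have Ss' : S s' = S s + Y by rewrite /s' !SD addrA.
  pose v := \sum_(i | i != i0) ln (absF A (w e' s' ^+ k i)).
  have sumE : \sum_i ln (absF A (w e' s' ^+ k i)) = g e s + v.
    by rewrite (bigD1 i0 isT) (w_rel e' (raise s one) i0) lower_raise.
  apply: (@two_sided_bound _ _ _ p _ v) => //; first by rewrite /p.
  - by apply: le_trans (C1P s) _; rewrite lerD2l ler_norm.
  - apply: sum_ord_le => [|i]; first by rewrite addr_ge0 // addr_ge0 // /p.
    apply: le_trans (ln_absF_le A (t_gt0 s') (t_le1 _) (wk_abs _ _ _)) _.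
    have := ler_norm (ln 2 - ln tau); rewrite -/p ln_t Ss'; clear; lra.
  - by have := C2P s'; rewrite sumE Ss' ler_norml => /andP[].
have al_sum : 0 < \sum_l al l.
  have [l _] := hb i0; rewrite (bigD1 l) //= ltr_pwDl //.
  by apply: sumr_ge0 => l' _; exact: ltW.
have [f [f_ge f_eq]] := averaged_solution (fun l => ltW (al_gt0 l)) al_sum g_bnd g_le g_eq.
(* Multiplicities are bounded by the degree; together with -1 <= f and the equation
   at raise e (b i0), this bounds f from above. *)
have a_le e : (a e < size PC)%N.
  have [aP' _] := aP e; have [h PCh hz] := aP' _ (th_prim e (fun=> 0%N)).
  have h0 : h != 0 by apply: contraNneq hz => ->; rewrite root0.
  have X0 : ('X - (th e (fun=> 0%N))%:P) ^+ a e != 0.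
    by rewrite expf_neq0 // polyXsubC_eq0.
  rewrite /PC PCh (size_mul X0 h0) size_exp_XsubC addSn /=.
  by rewrite -[X in (X < _)%N]addn0 ltn_add2l size_poly_gt0.
have f_bnd e : `|f e| <= (size PC)%:R + d%:R.
  rewrite ler_norml; apply/andP; split.
    apply: le_trans (f_ge e); rewrite lerNl opprK.
    by have : (1 : R) <= d%:R by [rewrite ler1n]; have : 0 <= (size PC)%:R :> R by []; lra.
  have := f_eq (raise e (b i0)); rewrite (bigD1 i0) //= lower_raise rhoE.
  have : (a (raise e (b i0)))%:R <= (size PC)%:R :> R by rewrite ler_nat ltnW.
  have : \sum_(i | i != i0) - f (lower (raise e (b i0)) (b i)) <= d%:R * 1.
    by apply: sum_ord_le => // i; rewrite lerNl.
  rewrite sumrN.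
  have : 0 <= (ord (raise e (b i0)) == 1%N)%:R :> R by [].
  lra.
have [B BP] := prim_root_order_bound rs.
apply: (@no_bounded_solution R m d b rho f _ B hd hb hb' f_bnd f_eq).
  move=> e l ltB.
  have ord_gt : (e l < ord e)%N.
    rewrite /ord (bigD1 l) //=; apply: leq_trans (ltn_expl (e l) (hq l)) _.
    by rewrite leq_pmulr // prodn_gt0 // => l'; rewrite expn_gt0 q_gt0.
  have ordB : (B < ord e)%N by exact: ltn_trans ord_gt.
  rewrite /rho; have -> : (ord e == 1%N) = false by apply/negbTE; rewrite neq_ltn; lia.
  case ae : (a e) => [|a'] //.
  have [aP' _] := aP e; have [h PCh hz] := aP' _ (th_prim e (fun=> 0%N)).
  have th_rs : th e (fun=> 0%N) \in rs.
    by rewrite -rsP /PC PCh ae exprS -mulrA rootM root_XsubC eqxx.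
  by have := BP _ _ th_rs (th_prim e _); rewrite leqNgt ordB.
have ord0 : ord (fun=> 0%N) = 1%N by rewrite /ord big1.
rewrite /rho ord0; case ae : (a _) => [|a'] //.
have [aP' _] := aP (fun=> 0%N); have [h PCh hz] := aP' _ (th_prim (fun=> 0%N) (fun=> 0%N)).
have th_1 : th (fun=> 0%N) (fun=> 0%N) = 1.
  by have := prim_expr_order (th_prim (fun=> 0%N) (fun=> 0%N)); rewrite -/(ord _) ord0 expr1.
case/negP: PC1; rewrite -/(root PC 1) /PC PCh ae th_1 exprS -mulrA rootM root_XsubC eqxx //.
Qed.

End Main.

Local Open Scope classical_set_scope.
Local Open Scope nat_scope.

Theorem theorem1p1 (m d : nat) (hm : 1 <= m) (hd : 1 <= d)
    (q : 'I_m -> nat) (hq : forall j, 2 <= q j)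
    (hcop : forall j1 j2, j1 != j2 -> coprime (q j1) (q j2))
    (b : 'I_d -> 'I_m -> bool) (hb : forall i, exists j, b i j)
    (k : 'I_d -> nat) (hk : forall i, k i = \prod_(j < m) q j ^ b i j)
    (A : set nat) (hA : infinite_set A) :
  ~ exists c N : nat, forall n : nat, N <= n -> repr_count A k n = c.
Proof.
move=> [c [N rc]].
exact: (@not_eventually_constant Rdefinitions.R m d hd q hq hcop b hb k hk A hA c N rc).
Qed.
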